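(* Let $m>0$. For the solution $Q_i(s,R),P_i(s,R)$ of the regularized Hamiltonian system of $\Gamma$ with initial conditions $Q_1(0)=R$, $Q_2(0)=0$, $P_1(0)=0$, $P_2(0)=2m^{3/2}$, there exists $R\in(0,\sqrt{A_0}]$ such that $P_2(s_1(R),R)=0$, where $s_1(R)$ is the time when the first simultaneous binary collision happens.
   Context: Regularized system. Let $$\Gamma=\frac{1}{16}Q_2^2P_1^2+\frac{Q_2^2P_1^2-4Q_1Q_2P_1P_2+4Q_1^2P_2^2}{16m}-m^2Q_1^2-2mQ_2^2-\frac{2mQ_1^2Q_2^2}{Q_1^2+Q_2^2}-\frac{Q_1^2Q_2^2}{2Q_1^2+Q_2^2}-Q_1^2Q_2^2E,\qquad E=-1,$$ with Hamilton's equations $Q_i'=\partial\Gamma/\partial P_i$, $P_i'=-\partial\Gamma/\partial Q_i$ ($i=1,2$), $'=d/ds$. The solution with initial data $Q_1(0)=R$, $Q_2(0)=0$, $P_1(0)=0$, $P_2(0)=2m^{3/2}$ (which lies on $\Gamma=0$) is denoted $Q_i(s,R),P_i(s,R)$. The time $s_1=s_1(R)>0$ is the first time a simultaneous binary collision (SBC) happens, where SBC means $Q_1=0$, $Q_2\neq0$. In this setting $R\in(0,\sqrt{A_0}]$ and $Q_2>0$ for $0<s\le s_1$. Physical meaning: four collinear bodies of masses $1,m,m,1$ at positions $x_1,x_2,-x_2,-x_1$ ($x_1\ge x_2\ge0$), with total energy $-1$. Here $Q_1^2=x_1-x_2$, $Q_2^2=2x_2$, $P_1=4Q_1\dot x_1$,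 $P_2=2Q_2(\dot x_1+m\dot x_2)$, and physical time $t$ satisfies $dt/ds=Q_1^2Q_2^2$, $t(0)=0$. The motion starts at a binary collision of the inner bodies with $x_1(0)=A=R^2$, $x_2(0)=0$, $\dot x_1(0)=0$. Constant $A_0$: $A_0>0$ is the constant such that, with $t_1$ the physical time of the first SBC, the second body (position $x_2$) has no turning point for $t\in(0,t_1]$ whenever $0<A\le A_0$, and has at least one turning point for $t\in(0,t_1]$ if $A>A_0$. (A turning point of a body occurs at a time $t^*$ when its velocity $v$ vanishes and there are $t_a<t^*<t_b$ such that $v$ has one strict sign on $[t_a,t^* )$ and the opposite strict sign on $(t^*,t_b]$.) *)

(* Defs.v *)
From Stdlib Require Import Reals.
From Coquelicot Require Import Coquelicot.
Open Scope R_scope.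

Definition E : R := -1.

(* [Gamma] is [q1^2 * q2^2 * (H - E)], where [H] is the energy of the collinear
   bodies of masses 1, m, m, 1 at x1, x2, -x2, -x1, in the variables
   q1^2 = x1 - x2, q2^2 = 2 x2, p1 = 4 q1 x1', p2 = 2 q2 (x1' + m x2').
   For m <> 0 it is smooth away from total collapse q1 = q2 = 0. *)
Definition Gamma (m q1 q2 p1 p2 : R) : R :=
  1 / 16 * q2 ^ 2 * p1 ^ 2
  + (q2 ^ 2 * p1 ^ 2 - 4 * q1 * q2 * p1 * p2 + 4 * q1 ^ 2 * p2 ^ 2) / (16 * m)
  - m ^ 2 * q1 ^ 2
  - 2 * m * q2 ^ 2
  - 2 * m * q1 ^ 2 * q2 ^ 2 / (q1 ^ 2 + q2 ^ 2)
  - q1 ^ 2 * q2 ^ 2 / (2 * q1 ^ 2 + q2 ^ 2)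
  - q1 ^ 2 * q2 ^ 2 * E.

Record orbit := Orbit { Q1 : R -> R; Q2 : R -> R; P1 : R -> R; P2 : R -> R }.

Definition hamilton_at (m : R) (z : orbit) (s : R) : Prop :=
  is_derive (Q1 z) s
    (Derive (fun p => Gamma m (Q1 z s) (Q2 z s) p (P2 z s)) (P1 z s)) /\
  is_derive (Q2 z) s
    (Derive (fun p => Gamma m (Q1 z s) (Q2 z s) (P1 z s) p) (P2 z s)) /\
  is_derive (P1 z) s
    (- Derive (fun q => Gamma m q (Q2 z s) (P1 z s) (P2 z s)) (Q1 z s)) /\
  is_derive (P2 z) s
    (- Derive (fun q => Gamma m (Q1 z s) q (P1 z s) (P2 z s)) (Q2 z s)).

(* The solution starting at Q1 = r, on an open interval ]a, b[ containing 0.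
   A solution may end in total collapse, so it need not be defined for all
   times; total collapse is excluded because [Gamma] is singular there. The
   values of [z] outside ]a, b[ are irrelevant. *)
Definition solution (m r a b : R) (z : orbit) : Prop :=
  a < 0 < b /\
  Q1 z 0 = r /\ Q2 z 0 = 0 /\ P1 z 0 = 0 /\ P2 z 0 = 2 * Rpower m (3 / 2) /\
  forall s, a < s < b ->
    ~ (Q1 z s = 0 /\ Q2 z s = 0) /\ hamilton_at m z s.

Definition SBC (z : orbit) (s : R) : Prop := Q1 z s = 0 /\ Q2 z s <> 0.

Definition first_SBC (z : orbit) (s1 : R) : Prop :=
  0 < s1 /\ SBC z s1 /\ forall s, 0 < s < s1 -> ~ SBC z s.

Definition solution_to_SBC (m r a b : R) (z : orbit) (s1 : R) : Prop :=
  solution m r a b z /\ s1 < b /\ first_SBC z s1.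

Definition physical_time (z : orbit) (s : R) : R :=
  RInt (fun u => Q1 z u ^ 2 * Q2 z u ^ 2) 0 s.

(* [x2] is the position of the second body as a function of physical time;
   physical time is strictly increasing in s along a solution. *)
Definition second_body (a b : R) (z : orbit) (x2 : R -> R) : Prop :=
  forall s, a < s < b -> x2 (physical_time z s) = Q2 z s ^ 2 / 2.

(* The velocity is required to exist, as it does not at a collision. *)
Definition turning_point (x : R -> R) (t : R) : Prop :=
  exists (v : R -> R) (ta tb : R),
    ta < t < tb /\
    (forall u, ta <= u <= tb -> is_derive x u (v u)) /\
    v t = 0 /\
    (((forall u, ta <= u < t -> 0 < v u) /\ (forall u, t < u <= tb -> v u < 0))
     \/
     ((forall u, ta <= u < t -> v u < 0) /\ (forall u, t < u <= tb -> 0 < v u))).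

Definition second_body_turns (a b : R) (z : orbit) (s1 : R) : Prop :=
  exists x2 : R -> R, second_body a b z x2 /\
    exists t : R, 0 < t <= physical_time z s1 /\ turning_point x2 t.

(* The initial position of the outer body is A = r^2. For A <= A0 the first
   simultaneous binary collision is part of the condition; for A > A0, where an
   orbit might end in total collapse instead, only the orbits reaching such a
   collision are constrained. At most one A0 satisfies this. *)
Definition is_A0 (m A0 : R) : Prop :=
  0 < A0 /\
  (forall A, 0 < A <= A0 ->
    (exists a b z s1, solution_to_SBC m (sqrt A) a b z s1) /\
    (forall a b z s1, solution_to_SBC m (sqrt A) a b z s1 ->
       ~ second_body_turns a b z s1)) /\
  (forall A, A0 < A ->
    forall a b z s1, solution_to_SBC m (sqrt A) a b z s1 ->
      second_body_turns a b z s1).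

(* Main.v *)
Require Import Defs.
From Stdlib Require Import Reals Lra Psatz Classical.
From Coquelicot Require Import Coquelicot.
Open Scope R_scope.

(** Say that [r] is good if [P2 > 0] on [0, s1(r)]. For [r < 1/2] the moment of
    inertia is convex up to the SBC, which makes [r] good. Being good is an open
    condition, by continuous dependence on [r]. If [P2 (s1(r)) <> 0] for all
    [r <= sqrt A0], then being bad is open too, because [P2] cannot vanish inside
    ]0, s1[ without changing sign; so [sqrt A0] would be good, and so would some
    larger [r]. But the second body of a good orbit has no turning point, as its
    velocity is a positive combination of [P2 / Q2 > 0] and [- P1 / Q1 >= 0].

    For continuous dependence and uniqueness, the Hamiltonian field is replaced by
    a globally bounded and Lipschitz one that agrees with it near a compact piece
    of an orbit; Picard iteration and Gronwall's inequality then apply on the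
    whole line. *)

(** * Global flow of a bounded Lipschitz field *)

(** An intermediate value argument for [P2 (s1(r))] lacks an endpoint with a negative value: the
    definition of [A0] speaks of turning points of the second body, not of the sign of [P2]. Only
    one implication links the two, from [P2 > 0] to the absence of turning points, and it needs
    positivity along the whole orbit. This is why good is a condition on all of [0, s1(r)], and why
    the proof is a supremum argument by contradiction.

    Stability of the collision itself is the second point. On [Gamma = 0] an SBC has [P1 <> 0], in
    fact [P1 < 0], so [Q1] crosses zero with nonzero speed and nearby orbits collide at a nearby
    time. That is also how orbits with [r] slightly above [sqrt A0] are known to reach an SBC, which
    [is_A0] does not promise.

    The obstacle to continuous dependence is that orbits may end in total collapse, so a nearby
    orbit must first be shown to live as long as the given one. *)

Lemma is_derive_nonneg_le (f f' : R -> R) (a b : R) :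
  a <= b -> (forall u, a <= u <= b -> is_derive f u (f' u)) ->
  (forall u, a < u < b -> 0 <= f' u) -> f a <= f b.
Proof.
intros [hab | <-] hd hp; [|lra].
destruct (MVT_cor2 f f' a b hab) as (c & e & hc).
- intros u hu; apply is_derive_Reals; auto.
- specialize (hp c hc); nra.
Qed.

Lemma is_derive_pos_lt (f f' : R -> R) (a b : R) :
  a < b -> (forall u, a <= u <= b -> is_derive f u (f' u)) ->
  (forall u, a < u < b -> 0 < f' u) -> f a < f b.
Proof.
intros hab hd hp.
destruct (MVT_cor2 f f' a b hab) as (c & e & hc).
- intros u hu; apply is_derive_Reals; auto.
- specialize (hp c hc); nra.
Qed.

Lemma is_derive_continuity_pt (f : R -> R) (x l : R) :
  is_derive f x l -> continuity_pt f x.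
Proof.
intros h; apply continuity_pt_filterlim, (ex_derive_continuous f); now exists l.
Qed.

Lemma Rmin_Rmax_cases (s : R) :
  (0 <= s /\ Rmin 0 s = 0 /\ Rmax 0 s = s) \/ (s <= 0 /\ Rmin 0 s = s /\ Rmax 0 s = 0).
Proof.
destruct (Rle_dec 0 s).
- left; rewrite Rmin_left, Rmax_right by lra; auto.
- right; rewrite Rmin_right, Rmax_left by lra; repeat split; lra.
Qed.

(** The derivative of [c * exp (K * u)] dominates that of [h] and of [- h], so adding or subtracting
    [h] leaves a nondecreasing function. *)
Lemma exp_growth_fwd (h h' : R -> R) (c K s : R) :
  0 <= s -> (forall u, 0 <= u <= s -> is_derive h u (h' u)) ->
  (forall u, 0 <= u <= s -> Rabs (h' u) <= c * K * exp (K * u)) ->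
  Rabs (h s - h 0) <= c * (exp (K * s) - 1).
Proof.
intros hs hd hb.
assert (he : forall u, is_derive (fun u => c * exp (K * u)) u (c * K * exp (K * u))).
{ intros u; auto_derive; [exact I | ring]. }
assert (h1 : c * exp (K * 0) - h 0 <= c * exp (K * s) - h s).
{ apply (is_derive_nonneg_le (fun u => c * exp (K * u) - h u)
    (fun u => c * K * exp (K * u) - h' u)); auto.
  - intros u hu; apply (is_derive_minus (fun u => c * exp (K * u)) h); auto.
  - intros u hu; specialize (hb u ltac:(lra)); apply Rabs_le_between in hb; lra. }
assert (h2 : c * exp (K * 0) + h 0 <= c * exp (K * s) + h s).
{ apply (is_derive_nonneg_le (fun u => c * exp (K * u) + h u)
    (fun u => c * K * exp (K * u) + h' u)); auto.
  - intros u hu; apply (is_derive_plus (fun u => c * exp (K * u)) h); auto.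
  - intros u hu; specialize (hb u ltac:(lra)); apply Rabs_le_between in hb; lra. }
rewrite Rmult_0_r, exp_0 in h1, h2.
apply Rabs_le_between; lra.
Qed.

Lemma exp_growth (h h' : R -> R) (c K s : R) :
  (forall u, Rmin 0 s <= u <= Rmax 0 s -> is_derive h u (h' u)) ->
  (forall u, Rmin 0 s <= u <= Rmax 0 s -> Rabs (h' u) <= c * K * exp (K * Rabs u)) ->
  Rabs (h s - h 0) <= c * (exp (K * Rabs s) - 1).
Proof.
intros hd hb.
destruct (Rmin_Rmax_cases s) as [(hs & e1 & e2) | (hs & e1 & e2)];
  rewrite e1, e2 in hd, hb.
- rewrite (Rabs_pos_eq s) by auto; apply exp_growth_fwd with h'; auto.
  intros u hu; rewrite <- (Rabs_pos_eq u) at 2 by lra; auto.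
- rewrite (Rabs_left1 s) by auto.
  assert (A := exp_growth_fwd (fun u => h (- u)) (fun u => - h' (- u)) c K (- s)).
  cbn beta in A; rewrite Ropp_involutive, Ropp_0 in A; apply A; [lra | |].
  + intros u hu; assert (hd' := hd (- u) ltac:(lra)).
    replace (- h' (- u)) with (scal (-1) (h' (- u))) by (compute; ring).
    apply (is_derive_comp h Ropp); auto.
    auto_derive; [exact I | ring].
  + intros u hu; rewrite Rabs_Ropp.
    replace u with (Rabs (- u)) at 2 by (rewrite Rabs_left1; lra).
    apply hb; lra.
Qed.

Lemma exp_Rabs_ge_1 (K s : R) : 0 <= K -> 1 <= exp (K * Rabs s).
Proof.
intros hK; assert (hs := Rabs_pos s).
rewrite <- exp_0.
destruct (Rle_lt_or_eq_dec 0 (K * Rabs s)) as [h | h]; [nra | |].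
- left; now apply exp_increasing.
- right; now rewrite <- h.
Qed.

Lemma half_pow_small (C eps : R) : 0 < eps -> exists n : nat, C * (1 / 2) ^ n < eps.
Proof.
intros he.
assert (hl : is_lim_seq (fun n => C * (1 / 2) ^ n) 0).
{ replace (Finite 0) with (Rbar_mult C 0) by (simpl; now rewrite Rmult_0_r).
  apply is_lim_seq_scal_l, is_lim_seq_geom; rewrite Rabs_pos_eq; lra. }
apply is_lim_seq_spec in hl.
destruct (hl (mkposreal eps he)) as [n hn].
exists n; specialize (hn n (le_n n)); simpl in hn.
rewrite Rminus_0_r in hn; apply Rle_lt_trans with (2 := hn), Rle_abs.
Qed.

Lemma le_of_half_pow (x y C : R) : (forall n : nat, x <= y + C * (1 / 2) ^ n) -> x <= y.
Proof.
intros h; apply le_epsilon; intros eps he.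
destruct (half_pow_small C eps he) as [n hn]; specialize (h n); lra.
Qed.

(** The intervals of radius [2 * C * (1 / 2) ^ k] around [u k] are nested, and the limit is the
    supremum of their left ends. The conclusion is a sigma type, so that the limit can be used as a
    function of further parameters. *)
Lemma geometric_limit (u : nat -> R) (C : R) :
  (forall k, Rabs (u (S k) - u k) <= C * (1 / 2) ^ k) ->
  {l : R | forall k, Rabs (l - u k) <= 2 * C * (1 / 2) ^ k}.
Proof.
intros h.
assert (lo : forall k n, u k - 2 * C * (1 / 2) ^ k <= u (k + n)%nat - 2 * C * (1 / 2) ^ (k + n)).
{ intros k n; induction n as [|n IH]; [rewrite Nat.add_0_r; lra|].
  rewrite Nat.add_succ_r; specialize (h (k + n)%nat); apply Rabs_le_between in h.
  simpl; lra. }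
assert (up : forall k n, u (k + n)%nat + 2 * C * (1 / 2) ^ (k + n) <= u k + 2 * C * (1 / 2) ^ k).
{ intros k n; induction n as [|n IH]; [rewrite Nat.add_0_r; lra|].
  rewrite Nat.add_succ_r; specialize (h (k + n)%nat); apply Rabs_le_between in h.
  simpl; lra. }
assert (C0 : 0 <= C).
{ specialize (h 0%nat); assert (A := Rabs_pos (u 1%nat - u 0%nat)); simpl in h; lra. }
assert (pp : forall n, 0 <= 2 * C * (1 / 2) ^ n).
{ intros n; apply Rmult_le_pos; [lra | apply pow_le; lra]. }
assert (lu : forall j k, u j - 2 * C * (1 / 2) ^ j <= u k + 2 * C * (1 / 2) ^ k).
{ intros j k; specialize (lo j k); specialize (up k j); rewrite Nat.add_comm in up.
  specialize (pp (j + k)%nat); lra. }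
destruct (completeness (fun x => exists j, x = u j - 2 * C * (1 / 2) ^ j)) as [l [l1 l2]].
- exists (u 0%nat + 2 * C * (1 / 2) ^ 0); intros x [j ->]; apply lu.
- now exists (u 0%nat - 2 * C * (1 / 2) ^ 0), 0%nat.
- exists l; intros k; apply Rabs_le_between; split.
  + enough (u k - 2 * C * (1 / 2) ^ k <= l) by lra; apply l1; now exists k.
  + enough (l <= u k + 2 * C * (1 / 2) ^ k) by lra.
    apply l2; intros x [j ->]; apply lu.
Qed.

Definition bounded_by {T : Type} (g : T -> R) (B : R) : Prop := forall x, Rabs (g x) <= B.

(** Lipschitz for the sup norm, phrased through a common bound [d] on all coordinates, so that no
    supremum over [I] has to be formed. *)
Definition sup_Lipschitz {I : Type} (g : (I -> R) -> R) (L : R) : Prop :=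
  forall x y d, (forall i, Rabs (x i - y i) <= d) -> Rabs (g x - g y) <= L * d.

Definition flow {I : Type} (f : I -> (I -> R) -> R) (x : I -> R -> R) (s : R) : Prop :=
  forall i, is_derive (x i) s (f i (fun j => x j s)).

Section CauchyProblem.
Variables (I : Type) (f : I -> (I -> R) -> R) (B L : R).
Hypothesis hB : 0 < B.
Hypothesis hL : 0 < L.
Hypothesis f_bounded : forall i, bounded_by (f i) B.
Hypothesis f_Lipschitz : forall i, sup_Lipschitz (f i) L.

(** If the difference is at most [D * exp (K * Rabs t)] with [K = 2 * L], integrating the Lipschitz
    estimate improves [D] to [d + D / 2]. Iterating from the crude estimate that [B] provides drives
    [D] to the fixed point [2 * d]. *)
Lemma gronwall (x y : I -> R -> R) (d s : R) :
  0 <= d ->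
  (forall u, Rmin 0 s <= u <= Rmax 0 s -> flow f x u /\ flow f y u) ->
  (forall i, Rabs (x i 0 - y i 0) <= d) ->
  forall i, Rabs (x i s - y i s) <= 2 * d * exp (2 * L * Rabs s).
Proof.
intros hd.
set (K := 2 * L); set (C := 2 * B / K).
assert (hK : 0 < K) by (unfold K; lra).
assert (hC : 0 < C) by (apply Rdiv_lt_0_compat; lra).
intros hf h0.
assert (key : forall n : nat, forall t, Rmin 0 s <= t <= Rmax 0 s -> forall i,
  Rabs (x i t - y i t) <= 2 * d * exp (K * Rabs t) + C * (1 / 2) ^ n * exp (K * Rabs t)).
{ assert (hsub : forall t, Rmin 0 s <= t <= Rmax 0 s -> forall u,
    Rmin 0 t <= u <= Rmax 0 t -> Rmin 0 s <= u <= Rmax 0 s).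
  { intros t ht u hu.
    destruct (Rmin_Rmax_cases s) as [(? & ? & ?) | (? & ? & ?)];
    destruct (Rmin_Rmax_cases t) as [(? & ? & ?) | (? & ? & ?)]; lra. }
  assert (hdiff : forall t, Rmin 0 s <= t <= Rmax 0 s -> forall i u,
    Rmin 0 t <= u <= Rmax 0 t -> is_derive (fun u => x i u - y i u) u
      (f i (fun j => x j u) - f i (fun j => y j u))).
  { intros t ht i u hu; destruct (hf u (hsub t ht u hu)) as [hx hy].
    apply (is_derive_minus (x i) (y i)); auto. }
  induction n as [|n IH]; intros t ht i; assert (e1 := exp_Rabs_ge_1 K t (Rlt_le _ _ hK)).
  - assert (A := exp_growth _ _ C K t (hdiff t ht i)); cbv beta in A.
    assert (A' : Rabs (x i t - y i t - (x i 0 - y i 0)) <= C * (exp (K * Rabs t) - 1)).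
    { apply A; intros u hu.
      replace (C * K) with (B + B) by (unfold C; field; lra).
      assert (e2 := exp_Rabs_ge_1 K u (Rlt_le _ _ hK)).
      assert (b1 := f_bounded i (fun j => x j u)); assert (b2 := f_bounded i (fun j => y j u)).
      apply Rabs_le_between in b1; apply Rabs_le_between in b2.
      apply Rabs_le_between; nra. }
    assert (b := h0 i); simpl.
    apply Rabs_le_between in A'; apply Rabs_le_between in b; apply Rabs_le_between; nra.
  - set (c := (2 * d + C * (1 / 2) ^ n) / 2).
    assert (A := exp_growth _ _ c K t (hdiff t ht i)); cbv beta in A.
    assert (A' : Rabs (x i t - y i t - (x i 0 - y i 0)) <= c * (exp (K * Rabs t) - 1)).
    { apply A; intros u hu.
      replace (c * K * exp (K * Rabs u)) with
        (L * (2 * d * exp (K * Rabs u) + C * (1 / 2) ^ n * exp (K * Rabs u)))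
        by (unfold c, K; field).
      apply f_Lipschitz; intros j; apply IH; eauto. }
    assert (b := h0 i).
    assert (p := pow_lt (1 / 2) n ltac:(lra)).
    assert (q : 0 < C * (1 / 2) ^ n) by nra.
    apply Rabs_le_between in A'; apply Rabs_le_between in b.
    unfold c in A'; simpl.
    apply Rabs_le_between; nra. }
intros i; apply le_of_half_pow with (C * exp (K * Rabs s)); intros n.
replace (C * exp (K * Rabs s) * (1 / 2) ^ n) with (C * (1 / 2) ^ n * exp (K * Rabs s)) by ring.
apply key.
destruct (Rmin_Rmax_cases s) as [(? & ? & ?) | (? & ? & ?)]; lra.
Qed.

Lemma Rabs_lipschitz_continuous (g : R -> R) (C : R) :
  (forall u v, Rabs (g u - g v) <= C * Rabs (u - v)) -> forall u, continuous g u.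
Proof.
intros h u; apply filterlim_locally; intros eps.
assert (hp : 0 < eps / (Rabs C + 1)).
{ apply Rdiv_lt_0_compat; [apply cond_pos | assert (A := Rabs_pos C); lra]. }
exists (mkposreal _ hp); intros v hv.
change (Rabs (g v - g u) < eps); change (Rabs (v - u) < eps / (Rabs C + 1)) in hv.
apply Rle_lt_trans with (1 := h v u).
assert (A := Rabs_pos C); assert (A' := Rle_abs C); assert (A2 := Rabs_pos (v - u)).
apply Rle_lt_trans with ((Rabs C + 1) * Rabs (v - u)); [nra|].
apply Rlt_le_trans with ((Rabs C + 1) * (eps / (Rabs C + 1))); [nra | right; field; lra].
Qed.

Lemma is_derive_RInt_continuous (g : R -> R) (c s : R) :
  (forall u, continuous g u) -> is_derive (fun t => c + RInt g 0 t) s (g s).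
Proof.
intros h.
replace (g s) with (0 + g s) by ring.
apply (is_derive_plus (fun _ : R => c) (fun t => RInt g 0 t));
  [exact (is_derive_const c s)|].
apply (is_derive_RInt g (fun t => RInt g 0 t) 0 s); auto.
apply filter_forall; intros t; apply (RInt_correct (V := R_CompleteNormedModule)).
apply (ex_RInt_continuous (V := R_CompleteNormedModule)); auto.
Qed.

Lemma is_derive_bounded_Rabs_lipschitz (g g' : R -> R) (C : R) :
  (forall u, is_derive g u (g' u)) -> (forall u, Rabs (g' u) <= C) ->
  forall u v, Rabs (g u - g v) <= C * Rabs (u - v).
Proof.
intros hd hb.
assert (key : forall u v, v < u -> Rabs (g u - g v) <= C * Rabs (u - v)).
{ intros u v huv; destruct (MVT_cor2 g g' v u huv) as (c & e & _).
  - intros; apply is_derive_Reals; auto.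
  - rewrite e, Rabs_mult; apply Rmult_le_compat_r; auto using Rabs_pos. }
intros u v; destruct (Rtotal_order u v) as [h | [<- | h]]; auto.
- rewrite Rabs_minus_sym, (Rabs_minus_sym u v); auto.
- rewrite Rminus_eq_0, Rminus_eq_0, Rabs_R0; lra.
Qed.

Fixpoint picard (x0 : I -> R) (n : nat) (i : I) : R -> R :=
  match n with
  | O => fun _ => x0 i
  | S k => fun s => x0 i + RInt (fun u => f i (fun j => picard x0 k j u)) 0 s
  end.

Lemma field_along_lipschitz (x : I -> R -> R) (i : I) :
  (forall j u v, Rabs (x j u - x j v) <= B * Rabs (u - v)) ->
  forall u, continuous (fun u => f i (fun j => x j u)) u.
Proof.
intros h; apply (Rabs_lipschitz_continuous _ (L * B)); intros u v.
rewrite Rmult_assoc; apply f_Lipschitz; auto.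
Qed.

(** The constant comes from the bound on the field alone, hence is the same for all [n] and survives
    in the limit. It also makes every integrand continuous. *)
Lemma picard_lipschitz (x0 : I -> R) (n : nat) :
  forall i u v, Rabs (picard x0 n i u - picard x0 n i v) <= B * Rabs (u - v).
Proof.
induction n as [|n IH]; intros i u v.
- simpl; rewrite Rminus_eq_0, Rabs_R0; assert (A := Rabs_pos (u - v)); nra.
- apply (is_derive_bounded_Rabs_lipschitz (picard x0 (S n) i)
    (fun u => f i (fun j => picard x0 n j u))).
  + intros t; apply (is_derive_RInt_continuous (fun u => f i (fun j => picard x0 n j u))).
    now apply field_along_lipschitz.
  + intros t; apply f_bounded.
Qed.

Lemma is_derive_picard (x0 : I -> R) (n : nat) (i : I) (s : R) :
  is_derive (picard x0 (S n) i) s (f i (fun j => picard x0 n j s)).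
Proof.
apply (is_derive_RInt_continuous (fun u => f i (fun j => picard x0 n j u))).
apply field_along_lipschitz, picard_lipschitz.
Qed.

Lemma picard_0 (x0 : I -> R) (n : nat) (i : I) : picard x0 n i 0 = x0 i.
Proof. destruct n; simpl; [reflexivity|]. rewrite RInt_point; apply Rplus_0_r. Qed.

(** With the weight [exp (2 * L * Rabs s)] the Picard map contracts by 1/2 on the whole line, so
    there are no short time intervals to glue. *)
Lemma picard_step (x0 : I -> R) (n : nat) (i : I) (s : R) :
  Rabs (picard x0 (S n) i s - picard x0 n i s)
    <= B / L * exp (2 * L * Rabs s) * (1 / 2) ^ n.
Proof.
assert (hC : 0 < B / L) by (apply Rdiv_lt_0_compat; lra).
revert i s; induction n as [|n IH]; intros i s.
- assert (A := exp_growth (picard x0 1 i) (fun u => f i (fun j => picard x0 0 j u))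
    (B / L) (2 * L) s (fun u _ => is_derive_picard x0 0 i u)).
  assert (A' : Rabs (picard x0 1 i s - picard x0 1 i 0) <= B / L * (exp (2 * L * Rabs s) - 1)).
  { apply A; intros u _.
    apply Rle_trans with (1 := f_bounded i _).
    assert (e := exp_Rabs_ge_1 (2 * L) u ltac:(lra)).
    replace (B / L * (2 * L)) with (B + B) by (field; lra); nra. }
  rewrite (picard_0 x0 1) in A'; change (picard x0 0 i s) with (x0 i).
  rewrite pow_O; lra.
- set (c := B / L * (1 / 2) ^ n / 2).
  assert (hd : forall u, is_derive (fun u => picard x0 (S (S n)) i u - picard x0 (S n) i u) u
    (f i (fun j => picard x0 (S n) j u) - f i (fun j => picard x0 n j u))).
  { intros u; apply (is_derive_minus (picard x0 (S (S n)) i) (picard x0 (S n) i));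
      apply is_derive_picard. }
  assert (A := exp_growth _ _ c (2 * L) s (fun u _ => hd u)); cbv beta in A.
  rewrite !picard_0 in A.
  assert (hc : 0 < c).
  { unfold c; assert (p := pow_lt (1 / 2) n ltac:(lra)); nra. }
  rewrite Rminus_eq_0, Rminus_0_r in A.
  apply Rle_trans with (c * (exp (2 * L * Rabs s) - 1)).
  + apply A; intros u _.
    replace (c * (2 * L) * exp (2 * L * Rabs u)) with
      (L * (B / L * exp (2 * L * Rabs u) * (1 / 2) ^ n)) by (unfold c; field; lra).
    apply f_Lipschitz; intros j; apply IH.
  + unfold c in *; simpl; nra.
Qed.

Theorem global_flow (x0 : I -> R) :
  exists x : I -> R -> R, (forall i, x i 0 = x0 i) /\ forall s, flow f x s.
Proof.
set (lim := fun i s => geometric_limit (fun n => picard x0 n i s) _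
  (fun n => picard_step x0 n i s)).
set (x := fun i s => proj1_sig (lim i s)).
assert (hx : forall i s n, Rabs (x i s - picard x0 n i s)
  <= 2 * (B / L * exp (2 * L * Rabs s)) * (1 / 2) ^ n).
{ intros i s; exact (proj2_sig (lim i s)). }
assert (x_lip : forall j u v, Rabs (x j u - x j v) <= B * Rabs (u - v)).
{ intros j u v.
  apply le_of_half_pow with (2 * (B / L * exp (2 * L * Rabs u)) + 2 * (B / L * exp (2 * L * Rabs v))).
  intros n; assert (a1 := hx j u n); assert (a2 := hx j v n).
  assert (a3 := picard_lipschitz x0 n j u v).
  apply Rabs_le_between in a1; apply Rabs_le_between in a2; apply Rabs_le_between in a3.
  apply Rabs_le_between; lra. }
assert (x_int : forall i s, x i s = x0 i + RInt (fun u => f i (fun j => x j u)) 0 s).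
{ intros i s.
  set (y := fun s => x0 i + RInt (fun u => f i (fun j => x j u)) 0 s).
  change (x i s = y s).
  enough (h : Rabs (x i s - y s) <= 0).
  { apply Rabs_le_between in h; lra. }
  (* Both [x i s] and [y s] lie within [e * (1 / 2) ^ n] of the iterate [picard x0 (S n) i s]. *)
  set (e := B / L * exp (2 * L * Rabs s)).
  apply le_of_half_pow with (2 * e); intros n.
  assert (hd : forall u, is_derive (fun u => picard x0 (S n) i u - y u) u
    (f i (fun j => picard x0 n j u) - f i (fun j => x j u))).
  { intros u; apply (is_derive_minus (picard x0 (S n) i) y).
    - apply is_derive_picard.
    - apply (is_derive_RInt_continuous (fun u => f i (fun j => x j u))).
      now apply field_along_lipschitz. }
  set (c := B / L * (1 / 2) ^ n).
  assert (A := exp_growth _ _ c (2 * L) s (fun u _ => hd u)); cbv beta in A.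
  assert (y0 : y 0 = x0 i) by (unfold y; rewrite RInt_point; apply Rplus_0_r).
  rewrite picard_0, y0, Rminus_eq_0, Rminus_0_r in A.
  assert (A' : Rabs (picard x0 (S n) i s - y s) <= c * (exp (2 * L * Rabs s) - 1)).
  { apply A; intros u _.
    replace (c * (2 * L) * exp (2 * L * Rabs u)) with
      (L * (2 * (B / L * exp (2 * L * Rabs u)) * (1 / 2) ^ n)) by (unfold c; ring).
    apply f_Lipschitz; intros j; rewrite Rabs_minus_sym; apply hx. }
  assert (A2 := hx i s (S n)); fold e in A2.
  assert (hc : 0 < c).
  { unfold c; assert (p := pow_lt (1 / 2) n ltac:(lra)).
    apply Rmult_lt_0_compat; [apply Rdiv_lt_0_compat; lra | lra]. }
  replace (c * (exp (2 * L * Rabs s) - 1)) with (e * (1 / 2) ^ n - c) in A'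
    by (unfold c, e; ring).
  replace (2 * e * (1 / 2) ^ S n) with (e * (1 / 2) ^ n) in A2 by (simpl; field).
  apply Rabs_le_between in A'; apply Rabs_le_between in A2; apply Rabs_le_between; lra. }
exists x; split.
- intros i; rewrite x_int, RInt_point; apply Rplus_0_r.
- intros s i.
  apply is_derive_ext with (fun s => x0 i + RInt (fun u => f i (fun j => x j u)) 0 s).
  + intros t; symmetry; apply x_int.
  + apply (is_derive_RInt_continuous (fun u => f i (fun j => x j u))).
    now apply field_along_lipschitz.
Qed.

End CauchyProblem.

(** * The Hamiltonian flow *)

(** Boundedness is carried along because the Lipschitz constant of a product involves bounds on its
    factors. *)
Definition bounded_Lipschitz {I : Type} (g : (I -> R) -> R) : Prop :=
  exists B L, 0 <= B /\ 0 <= L /\ bounded_by g B /\ sup_Lipschitz g L.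

Lemma bounded_Lipschitz_const {I : Type} (c : R) :
  bounded_Lipschitz (fun _ : I -> R => c).
Proof.
exists (Rabs c), 0; repeat split; [apply Rabs_pos | lra | intros x; lra |].
intros x y d _; rewrite Rminus_eq_0, Rabs_R0; lra.
Qed.

Lemma bounded_Lipschitz_plus {I : Type} (g h : (I -> R) -> R) :
  bounded_Lipschitz g -> bounded_Lipschitz h -> bounded_Lipschitz (fun x => g x + h x).
Proof.
intros (B1 & L1 & ? & ? & b1 & l1) (B2 & L2 & ? & ? & b2 & l2).
exists (B1 + B2), (L1 + L2); repeat split; [lra | lra | |].
- intros x; specialize (b1 x); specialize (b2 x).
  apply Rle_trans with (1 := Rabs_triang _ _); lra.
- intros x y d hd; specialize (l1 x y d hd); specialize (l2 x y d hd).
  replace (g x + h x - (g y + h y)) with ((g x - g y) + (h x - h y)) by ring.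
  apply Rle_trans with (1 := Rabs_triang _ _); lra.
Qed.

Lemma bounded_Lipschitz_mult {I : Type} (g h : (I -> R) -> R) :
  bounded_Lipschitz g -> bounded_Lipschitz h -> bounded_Lipschitz (fun x => g x * h x).
Proof.
intros (B1 & L1 & ? & ? & b1 & l1) (B2 & L2 & ? & ? & b2 & l2).
exists (B1 * B2), (B1 * L2 + B2 * L1); repeat split; [nra | nra | |].
- intros x; specialize (b1 x); specialize (b2 x).
  rewrite Rabs_mult; apply Rmult_le_compat; auto using Rabs_pos.
- intros x y d hd; specialize (l1 x y d hd); specialize (l2 x y d hd).
  specialize (b1 x); specialize (b2 y).
  replace (g x * h x - g y * h y) with (g x * (h x - h y) + h y * (g x - g y)) by ring.
  apply Rle_trans with (1 := Rabs_triang _ _).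
  rewrite 2!Rabs_mult, Rmult_plus_distr_r, 2!Rmult_assoc.
  apply Rplus_le_compat; apply Rmult_le_compat; auto using Rabs_pos.
Qed.

(** The inverse has Lipschitz constant [/ c * / c] above [c], and [Rmax c] is 1-Lipschitz. *)
Lemma bounded_Lipschitz_inv_Rmax {I : Type} (c : R) (g : (I -> R) -> R) :
  0 < c -> bounded_Lipschitz g -> bounded_Lipschitz (fun x => / Rmax c (g x)).
Proof.
intros hc (B1 & L1 & ? & ? & b1 & l1).
assert (hm : forall x, c <= Rmax c (g x)) by (intros; apply Rmax_l).
assert (hi : forall x, 0 < / Rmax c (g x) <= / c).
{ intros x; specialize (hm x); split;
    [apply Rinv_0_lt_compat; lra | apply Rinv_le_contravar; lra]. }
assert (hc' := Rinv_0_lt_compat c hc).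
exists (/ c), (L1 * (/ c * / c)); repeat split; [lra | | |].
- apply Rmult_le_pos; [lra|]; nra.
- intros x; specialize (hi x); rewrite Rabs_pos_eq; lra.
- intros x y d hd; specialize (l1 x y d hd).
  assert (h1 := hm x); assert (h2 := hm y); assert (i1 := hi x); assert (i2 := hi y).
  replace (/ Rmax c (g x) - / Rmax c (g y)) with
    ((Rmax c (g y) - Rmax c (g x)) * (/ Rmax c (g x) * / Rmax c (g y)))
    by (field; lra).
  rewrite Rabs_mult, (Rabs_pos_eq (_ * _)) by nra.
  replace (L1 * (/ c * / c) * d) with (L1 * d * (/ c * / c)) by ring.
  apply Rmult_le_compat; [apply Rabs_pos | nra | | nra].
  apply Rle_trans with (2 := l1).
  unfold Rmax; destruct (Rle_dec c (g x)), (Rle_dec c (g y));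
    unfold Rabs; repeat destruct Rcase_abs; lra.
Qed.

Definition clamp (M u : R) : R := Rmax (- M) (Rmin M u).

Lemma clamp_id (M u : R) : Rabs u <= M -> clamp M u = u.
Proof.
intros h; apply Rabs_le_between in h; unfold clamp.
rewrite Rmin_right, Rmax_right; lra.
Qed.

Lemma bounded_Lipschitz_clamp {I : Type} (M : R) (i : I) :
  0 <= M -> bounded_Lipschitz (fun x => clamp M (x i)).
Proof.
intros hM; exists M, 1; repeat split; [lra | lra | |].
- intros x; unfold clamp, Rmax, Rmin.
  apply Rabs_le_between; repeat destruct Rle_dec; lra.
- intros x y d hd; specialize (hd i); rewrite Rmult_1_l.
  apply Rabs_le_between in hd; unfold clamp, Rmax, Rmin.
  apply Rabs_le_between; repeat destruct Rle_dec; lra.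
Qed.

Inductive coord := cq1 | cq2 | cp1 | cp2.

Definition coordinate (z : orbit) (i : coord) : R -> R :=
  match i with cq1 => Q1 z | cq2 => Q2 z | cp1 => P1 z | cp2 => P2 z end.

Definition orbit_of (x : coord -> R -> R) : orbit :=
  Orbit (x cq1) (x cq2) (x cp1) (x cp2).

(* The Hamiltonian vector field; [e1] and [e2] stand for [/ (q1^2 + q2^2)] and
   [/ (2 q1^2 + q2^2)]. *)
Definition field_expr (m q1 q2 p1 p2 e1 e2 : R) (i : coord) : R :=
  match i with
  | cq1 => / 8 * (q2 * q2 * p1)
           + / (8 * m) * (q2 * q2 * p1 + -2 * (q1 * q2 * p2))
  | cq2 => / (4 * m) * (2 * (q1 * q1 * p2) + -1 * (q1 * q2 * p1))
  | cp1 => / (4 * m) * (q2 * p1 * p2 + -2 * (q1 * p2 * p2))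
           + 2 * m * m * q1 + 4 * m * (q1 * (q2 * q2 * e1) * (q2 * q2 * e1))
           + 2 * (q1 * (q2 * q2 * e2) * (q2 * q2 * e2)) + -2 * (q1 * q2 * q2)
  | cp2 => - / 8 * (q2 * p1 * p1)
           + / (8 * m) * (2 * (q1 * p1 * p2) + -1 * (q2 * p1 * p1))
           + 4 * m * q2 + 4 * m * (q2 * (q1 * q1 * e1) * (q1 * q1 * e1))
           + 4 * (q2 * (q1 * q1 * e2) * (q1 * q1 * e2)) + -2 * (q1 * q1 * q2)
  end.

Definition dist1 (q1 q2 : R) : R := q1 * q1 + q2 * q2.
Definition dist2 (q1 q2 : R) : R := 2 * (q1 * q1) + q2 * q2.

Definition gamma_field (m : R) (i : coord) (x : coord -> R) : R :=
  field_expr m (x cq1) (x cq2) (x cp1) (x cp2)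
    (/ dist1 (x cq1) (x cq2)) (/ dist2 (x cq1) (x cq2)) i.

(** Clamping the coordinates removes the polynomial growth; keeping the denominators above [c]
    removes the singularity at total collapse. *)
Definition truncated_field (m M c : R) (i : coord) (x : coord -> R) : R :=
  field_expr m (clamp M (x cq1)) (clamp M (x cq2)) (clamp M (x cp1)) (clamp M (x cp2))
    (/ Rmax c (dist1 (clamp M (x cq1)) (clamp M (x cq2))))
    (/ Rmax c (dist2 (clamp M (x cq1)) (clamp M (x cq2)))) i.

(** Since [dist1 <= dist2], one lower bound controls both denominators. *)
Definition tame (M c : R) (x : coord -> R) : Prop :=
  (forall i, Rabs (x i) <= M) /\ c <= dist1 (x cq1) (x cq2).

Lemma truncated_field_tame (m M c : R) (i : coord) (x : coord -> R) :
  tame M c x -> truncated_field m M c i x = gamma_field m i x.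
Proof.
intros [hM hc]; unfold truncated_field, gamma_field.
rewrite !clamp_id by auto.
assert (c <= dist2 (x cq1) (x cq2)) by (unfold dist1, dist2 in *; nra).
rewrite !Rmax_right by auto; reflexivity.
Qed.

Lemma truncated_field_bounded_Lipschitz (m M c : R) :
  0 <= M -> 0 < c -> exists B L, 0 < B /\ 0 < L /\
    (forall i, bounded_by (truncated_field m M c i) B) /\
    (forall i, sup_Lipschitz (truncated_field m M c i) L).
Proof.
intros hM hc.
assert (h : forall i, bounded_Lipschitz (truncated_field m M c i)).
{ intros []; unfold truncated_field, field_expr, dist1, dist2;
    repeat (apply bounded_Lipschitz_plus || apply bounded_Lipschitz_mult ||
            apply bounded_Lipschitz_const || apply bounded_Lipschitz_inv_Rmax ||
            apply bounded_Lipschitz_clamp); auto. }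
destruct (h cq1) as (B1 & L1 & ? & ? & b1 & l1).
destruct (h cq2) as (B2 & L2 & ? & ? & b2 & l2).
destruct (h cp1) as (B3 & L3 & ? & ? & b3 & l3).
destruct (h cp2) as (B4 & L4 & ? & ? & b4 & l4).
exists (B1 + B2 + B3 + B4 + 1), (L1 + L2 + L3 + L4 + 1).
split; [lra | split; [lra | split]].
- intros i x; specialize (b1 x); specialize (b2 x); specialize (b3 x); specialize (b4 x).
  destruct i; lra.
- intros i x y d hd; specialize (l1 x y d hd); specialize (l2 x y d hd);
    specialize (l3 x y d hd); specialize (l4 x y d hd).
  assert (0 <= d) by (apply Rle_trans with (2 := hd cq1); apply Rabs_pos).
  destruct i; nra.
Qed.

Lemma dist1_pos (q1 q2 : R) : ~ (q1 = 0 /\ q2 = 0) -> 0 < dist1 q1 q2.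
Proof.
intros h; unfold dist1.
destruct (Req_dec q1 0) as [-> | h1]; [|nra].
assert (q2 <> 0) by tauto; nra.
Qed.

Lemma hamilton_at_iff_flow (m : R) (z : orbit) (s : R) :
  m <> 0 -> ~ (Q1 z s = 0 /\ Q2 z s = 0) ->
  hamilton_at m z s <-> flow (gamma_field m) (coordinate z) s.
Proof.
intros hm hq; apply dist1_pos in hq.
assert (hq2 : 0 < dist2 (Q1 z s) (Q2 z s)) by (unfold dist1, dist2 in *; nra).
assert (e1 : Derive (fun p => Gamma m (Q1 z s) (Q2 z s) p (P2 z s)) (P1 z s)
  = gamma_field m cq1 (fun j => coordinate z j s)).
{ apply is_derive_unique; unfold Gamma, gamma_field, field_expr, dist1, dist2 in *; simpl.
  auto_derive; [auto | field; lra]. }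
assert (e2 : Derive (fun p => Gamma m (Q1 z s) (Q2 z s) (P1 z s) p) (P2 z s)
  = gamma_field m cq2 (fun j => coordinate z j s)).
{ apply is_derive_unique; unfold Gamma, gamma_field, field_expr, dist1, dist2 in *; simpl.
  auto_derive; [auto | field; lra]. }
assert (e3 : - Derive (fun q => Gamma m q (Q2 z s) (P1 z s) (P2 z s)) (Q1 z s)
  = gamma_field m cp1 (fun j => coordinate z j s)).
{ rewrite <- (Ropp_involutive (gamma_field _ _ _)); f_equal.
  apply is_derive_unique; unfold Gamma, gamma_field, field_expr, dist1, dist2, E in *; simpl.
  auto_derive; [repeat split; try exact I; lra | field; repeat split; lra]. }
assert (e4 : - Derive (fun q => Gamma m (Q1 z s) q (P1 z s) (P2 z s)) (Q2 z s)
  = gamma_field m cp2 (fun j => coordinate z j s)).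
{ rewrite <- (Ropp_involutive (gamma_field _ _ _)); f_equal.
  apply is_derive_unique; unfold Gamma, gamma_field, field_expr, dist1, dist2, E in *; simpl.
  auto_derive; [repeat split; try exact I; lra | field; repeat split; lra]. }
unfold hamilton_at; rewrite e1, e2, e3, e4; split.
- intros (h1 & h2 & h3 & h4) []; assumption.
- intros h; exact (conj (h cq1) (conj (h cq2) (conj (h cp1) (h cp2)))).
Qed.

Definition initial (m r : R) (i : coord) : R :=
  match i with cq1 => r | cq2 => 0 | cp1 => 0 | cp2 => 2 * Rpower m (3 / 2) end.

Lemma solution_iff_flow (m r a b : R) (z : orbit) :
  m <> 0 ->
  solution m r a b z <->
  a < 0 < b /\ (forall i, coordinate z i 0 = initial m r i) /\
  forall s, a < s < b ->
    0 < dist1 (Q1 z s) (Q2 z s) /\ flow (gamma_field m) (coordinate z) s.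
Proof.
intros hm; split.
- intros (h0 & h1 & h2 & h3 & h4 & h); split; [assumption | split; [now intros []|]].
  intros s hs; destruct (h s hs) as [hq hh]; split; [now apply dist1_pos|].
  now apply hamilton_at_iff_flow.
- intros (h0 & h1 & h); split; [assumption|].
  repeat (split; [first [exact (h1 cq1) | exact (h1 cq2) | exact (h1 cp1) | exact (h1 cp2)]|]).
  intros s hs; destruct (h s hs) as [hq hh].
  assert (hq' : ~ (Q1 z s = 0 /\ Q2 z s = 0)).
  { intros [e1 e2]; rewrite e1, e2 in hq; unfold dist1 in hq; lra. }
  split; [assumption | now apply hamilton_at_iff_flow].
Qed.

(** * Compact pieces of orbits, uniqueness and continuous dependence *)

Lemma continuity_bounded (f : R -> R) (a b : R) :
  (forall s, a <= s <= b -> continuity_pt f s) ->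
  exists M, forall s, a <= s <= b -> Rabs (f s) <= M.
Proof.
intros hf; destruct (Rle_dec a b) as [hab | hab]; [|exists 0; intros; lra].
destruct (continuity_ab_maj f a b hab hf) as (u & hu & _).
destruct (continuity_ab_min f a b hab hf) as (v & hv & _).
exists (Rabs (f u) + Rabs (f v)); intros s hs.
specialize (hu s hs); specialize (hv s hs).
assert (A1 := Rle_abs (f u)); assert (A2 := Rle_abs (- f v)).
rewrite Rabs_Ropp in A2.
assert (A3 := Rabs_pos (f u)); assert (A4 := Rabs_pos (f v)).
apply Rabs_le_between; lra.
Qed.

Lemma continuity_pos_lower_bound (f : R -> R) (a b : R) :
  (forall s, a <= s <= b -> continuity_pt f s /\ 0 < f s) ->
  exists c, 0 < c /\ forall s, a <= s <= b -> c <= f s.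
Proof.
intros hf; destruct (Rle_dec a b) as [hab | hab]; [|exists 1; split; intros; lra].
destruct (continuity_ab_min f a b hab (fun s hs => proj1 (hf s hs))) as (v & hv & hv').
exists (f v); split; [now apply hf | assumption].
Qed.

Lemma solution_flow (m r a b : R) (z : orbit) (s : R) :
  0 < m -> solution m r a b z -> a < s < b -> flow (gamma_field m) (coordinate z) s.
Proof.
intros hm hz hs; apply (solution_iff_flow m r a b z) in hz; [|lra].
now apply hz.
Qed.

Lemma solution_continuity_pt (m r a b : R) (z : orbit) (i : coord) (s : R) :
  0 < m -> solution m r a b z -> a < s < b -> continuity_pt (coordinate z i) s.
Proof.
intros hm hz hs; eapply is_derive_continuity_pt.
exact (solution_flow m r a b z s hm hz hs i).
Qed.

Lemma solution_tame (m r a b : R) (z : orbit) (s t : R) :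
  0 < m -> solution m r a b z -> a < s -> t < b ->
  exists M c, 0 <= M /\ 0 < c /\
    forall u, s <= u <= t -> tame M c (fun i => coordinate z i u).
Proof.
intros hm hz hs ht.
assert (hc : forall i u, s <= u <= t -> continuity_pt (coordinate z i) u).
{ intros i u hu; apply (solution_continuity_pt m r a b); auto; lra. }
assert (hb : exists M, 0 <= M /\ forall u, s <= u <= t -> forall i, Rabs (coordinate z i u) <= M).
{ destruct (continuity_bounded _ _ _ (hc cq1)) as [M1 h1].
  destruct (continuity_bounded _ _ _ (hc cq2)) as [M2 h2].
  destruct (continuity_bounded _ _ _ (hc cp1)) as [M3 h3].
  destruct (continuity_bounded _ _ _ (hc cp2)) as [M4 h4].
  exists (Rabs M1 + Rabs M2 + Rabs M3 + Rabs M4).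
  assert (p1 := Rabs_pos M1); assert (p2 := Rabs_pos M2);
    assert (p3 := Rabs_pos M3); assert (p4 := Rabs_pos M4).
  split; [lra|]; intros u hu i.
  assert (q1 := Rle_abs M1); assert (q2 := Rle_abs M2);
    assert (q3 := Rle_abs M3); assert (q4 := Rle_abs M4).
  specialize (h1 u hu); specialize (h2 u hu); specialize (h3 u hu); specialize (h4 u hu).
  destruct i; lra. }
destruct hb as (M & hM & hb).
assert (hd : forall u, s <= u <= t ->
  continuity_pt (fun u => dist1 (Q1 z u) (Q2 z u)) u /\ 0 < dist1 (Q1 z u) (Q2 z u)).
{ intros u hu; split.
  - apply (continuity_pt_plus (fun u => Q1 z u * Q1 z u) (fun u => Q2 z u * Q2 z u));
      apply continuity_pt_mult; first [exact (hc cq1 u hu) | exact (hc cq2 u hu)].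
  - apply (solution_iff_flow m r a b z) in hz; [|lra]; apply hz; lra. }
destruct (continuity_pos_lower_bound _ s t hd) as (c & hc0 & hcd).
exists M, c; split; [assumption | split; [assumption|]].
intros u hu; split; [now apply hb | now apply hcd].
Qed.

Lemma tame_flow_truncated (m M c : R) (x : coord -> R -> R) (s : R) :
  tame M c (fun i => x i s) ->
  flow (gamma_field m) x s <-> flow (truncated_field m M c) x s.
Proof.
intros ht; split; intros h i; specialize (h i); cbv beta in h |- *;
  now rewrite (truncated_field_tame m M c i _ ht) in *.
Qed.

(** The larger [M] and the smaller [c] make one truncated field govern both orbits, and Gronwall
    with [d = 0] gives equality. *)
Lemma solution_unique (m r a b a' b' : R) (z w : orbit) (s : R) :
  0 < m -> solution m r a b z -> solution m r a' b' w ->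
  0 <= s -> s < b -> s < b' -> forall i, coordinate z i s = coordinate w i s.
Proof.
intros hm hz hw h0 hb hb' i.
assert (z0 := proj1 hz); assert (w0 := proj1 hw).
destruct (solution_tame m r a b z 0 s hm hz ltac:(lra) hb) as (M1 & c1 & ? & ? & t1).
destruct (solution_tame m r a' b' w 0 s hm hw ltac:(lra) hb') as (M2 & c2 & ? & ? & t2).
set (M := Rmax M1 M2); set (c := Rmin c1 c2).
assert (hM1 := Rmax_l M1 M2); assert (hM2 := Rmax_r M1 M2).
assert (hc1 := Rmin_l c1 c2); assert (hc2 := Rmin_r c1 c2).
fold M in hM1, hM2; fold c in hc1, hc2.
assert (hc : 0 < c) by (unfold c, Rmin; destruct Rle_dec; lra).
destruct (truncated_field_bounded_Lipschitz m M c ltac:(lra) hc) as (B & L & hB & hL & fB & fL).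
assert (A : Rabs (coordinate z i s - coordinate w i s) <= 2 * 0 * exp (2 * L * Rabs s)).
{ apply (gronwall coord (truncated_field m M c) B L hB hL fB fL (coordinate z) (coordinate w)).
  - lra.
  - rewrite Rmin_left, Rmax_right by lra; intros u hu; split.
    + apply tame_flow_truncated; [|apply (solution_flow m r a b); auto; lra].
      destruct (t1 u hu) as [k1 k2]; split; [intros j; specialize (k1 j)|]; lra.
    + apply tame_flow_truncated; [|apply (solution_flow m r a' b'); auto; lra].
      destruct (t2 u hu) as [k1 k2]; split; [intros j; specialize (k1 j)|]; lra.
  - intros j; apply (solution_iff_flow m r) in hz; [|lra]; apply (solution_iff_flow m r) in hw; [|lra].
    destruct hz as (_ & hz & _); destruct hw as (_ & hw & _).
    rewrite hz, hw, Rminus_eq_0, Rabs_R0; lra. }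
rewrite Rmult_0_r, Rmult_0_l in A; apply Rabs_le_between in A; lra.
Qed.

Lemma tame_near (M c : R) (x y : coord -> R) (eta : R) :
  0 <= M -> 0 < c -> tame M c x -> 0 < eta <= 1 -> eta * (8 * M + 8) <= c ->
  (forall i, Rabs (y i - x i) <= eta) -> tame (M + 1) (c / 2) y.
Proof.
intros hM hc [h1 h2] he hec hy; split.
- intros i; specialize (h1 i); specialize (hy i).
  apply Rabs_le_between in h1; apply Rabs_le_between in hy; apply Rabs_le_between; lra.
(* Each square loses at most [eta * (2 * M + 2) <= c / 4], so [dist1] loses at most [c / 2]. *)
- assert (key : forall i, x i * x i - eta * (2 * M + 2) <= y i * y i).
  { intros i; specialize (h1 i); specialize (hy i).
    apply Rabs_le_between in h1; apply Rabs_le_between in hy.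
    replace (y i * y i) with (x i * x i + (y i - x i) * (2 * x i) + (y i - x i) * (y i - x i)) by ring.
    nra. }
  assert (k1 := key cq1); assert (k2 := key cq2); unfold dist1 in *; lra.
Qed.

(** The new orbit is built as a global flow of the truncated field, so Gronwall bounds its distance
    to [z] before anything is known about where it goes. Closeness then places it in the tame
    region, where it solves the original equations on all of ]s, t[; no continuation argument is
    involved. *)
Lemma solution_perturb (m r0 a b : R) (z : orbit) (s t eps : R) :
  0 < m -> solution m r0 a b z -> a < s < 0 -> 0 < t < b -> 0 < eps ->
  exists delta, 0 < delta /\ forall r, Rabs (r - r0) < delta ->
    exists y, solution m r s t y /\
      forall u i, s <= u <= t -> Rabs (coordinate y i u - coordinate z i u) < eps.
Proof.
intros hm hz hs ht heps.
destruct (solution_tame m r0 a b z s t hm hz ltac:(lra) ltac:(lra)) as (M & c & hM & hc & htame).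
destruct (truncated_field_bounded_Lipschitz m (M + 1) (c / 2) ltac:(lra) ltac:(lra))
  as (B & L & hB & hL & fB & fL).
set (eta := Rmin 1 (Rmin (eps / 2) (c / (8 * M + 8)))).
assert (hc8 : 0 < c / (8 * M + 8)) by (apply Rdiv_lt_0_compat; lra).
assert (he1 : eta <= 1) by apply Rmin_l.
assert (he2 : eta <= eps / 2) by (eapply Rle_trans; [apply Rmin_r | apply Rmin_l]).
assert (he3 : eta <= c / (8 * M + 8)) by (eapply Rle_trans; [apply Rmin_r | apply Rmin_r]).
assert (he0 : 0 < eta) by (unfold eta, Rmin; repeat destruct Rle_dec; lra).
assert (he4 : eta * (8 * M + 8) <= c).
{ apply Rle_trans with (c / (8 * M + 8) * (8 * M + 8)); [|right; field; lra].
  apply Rmult_le_compat_r; lra. }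
set (G := exp (2 * L * (t - s))).
assert (hG : 0 < G) by apply exp_pos.
exists (eta / (2 * G)); split; [apply Rdiv_lt_0_compat; lra|].
intros r hr.
destruct (global_flow coord (truncated_field m (M + 1) (c / 2)) B L hB hL fB fL (initial m r))
  as (x & x0 & hx).
assert (tame_z : forall u, s <= u <= t -> tame (M + 1) (c / 2) (fun i => coordinate z i u)).
{ intros u hu; destruct (htame u hu) as [k1 k2]; split; [intros j; specialize (k1 j)|]; lra. }
assert (near : forall u i, s <= u <= t -> Rabs (x i u - coordinate z i u) <= eta).
{ intros u i hu.
  apply Rle_trans with (2 * Rabs (r - r0) * exp (2 * L * Rabs u)).
  - apply (gronwall coord (truncated_field m (M + 1) (c / 2)) B L hB hL fB fL x (coordinate z)).
    + apply Rabs_pos.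
    + intros v hv; split; [apply hx|].
      assert (hv' : s <= v <= t).
      { destruct (Rmin_Rmax_cases u) as [(? & ? & ?) | (? & ? & ?)]; lra. }
      apply tame_flow_truncated; [now apply tame_z|].
      apply (solution_flow m r0 a b); auto; lra.
    + intros j; apply (solution_iff_flow m r0) in hz; [|lra]; destruct hz as (_ & hz & _).
      rewrite hz, x0; destruct j; simpl; rewrite ?Rminus_eq_0, ?Rabs_R0;
        first [apply Rle_refl | apply Rabs_pos].
  - assert (hG' : exp (2 * L * Rabs u) <= G).
    { assert (Rabs u <= t - s) by (apply Rabs_le_between; lra).
      destruct (Rle_lt_or_eq_dec (2 * L * Rabs u) (2 * L * (t - s))) as [h | h]; [nra | |].
      - left; now apply exp_increasing.
      - unfold G; rewrite h; lra. }
    assert (A := Rabs_pos (r - r0)).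
    replace eta with (2 * (eta / (2 * G)) * G) by (field; lra).
    apply Rmult_le_compat; [lra | left; apply exp_pos | lra | assumption]. }
assert (tame_x : forall u, s <= u <= t -> tame (M + 1) (c / 2) (fun i => x i u)).
{ intros u hu; apply (tame_near M c (fun i => coordinate z i u) _ eta); auto. }
assert (ex : forall i u, coordinate (orbit_of x) i u = x i u) by now intros [].
exists (orbit_of x); split.
- apply solution_iff_flow; [lra|]; split; [lra|split].
  + intros i; rewrite ex; apply x0.
  + intros u hu; destruct (tame_x u ltac:(lra)) as [k1 k2]; split; [simpl; lra|].
    intros i.
    assert (hf := proj2 (tame_flow_truncated m _ _ x u (tame_x u ltac:(lra))) (hx u) i).
    destruct i; exact hf.
- intros u i hu; rewrite ex; specialize (near u i hu); lra.
Qed.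

(** * Orbits up to the first simultaneous binary collision *)

Lemma continuity_pt_locally_pos (f : R -> R) (x : R) :
  continuity_pt f x -> 0 < f x ->
  exists d, 0 < d /\ forall y, Rabs (y - x) < d -> 0 < f y.
Proof.
intros hc hp; apply continuity_pt_filterlim in hc.
assert (hc' := proj1 (filterlim_locally f (f x)) hc (mkposreal _ hp)).
destruct hc' as [d hd]; exists d; split; [apply cond_pos|].
intros y hy; specialize (hd y hy); change (Rabs (f y - f x) < f x) in hd.
apply Rabs_def2 in hd; lra.
Qed.

(** The zero is the supremum of the times up to which [f] has stayed positive. *)
Lemma first_zero (f : R -> R) (a b : R) :
  a <= b -> (forall s, a <= s <= b -> continuity_pt f s) -> 0 < f a -> f b <= 0 ->
  exists s, a < s <= b /\ f s = 0 /\ forall u, a <= u < s -> 0 < f u.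
Proof.
intros hab hc fa fb.
destruct (completeness (fun s => a <= s <= b /\ forall u, a <= u <= s -> 0 < f u))
  as [s [s1 s2]].
- exists b; intros s hs; apply hs.
- exists a; split; [lra|]; intros u hu; replace u with a by lra; assumption.
- assert (has : a <= s).
  { apply s1; split; [lra|]; intros u hu; replace u with a by lra; assumption. }
  assert (hsb : s <= b) by (apply s2; intros u hu; apply hu).
  assert (hlt : forall u, a <= u < s -> 0 < f u).
  { intros u hu; destruct (Rlt_dec 0 (f u)) as [h | h]; [assumption|].
    exfalso; enough (s <= u) by lra.
    apply s2; intros v [hv1 hv2]; destruct (Rle_dec v u) as [|hvu]; [assumption|].
    exfalso; apply h, hv2; lra. }
  assert (fs : f s = 0).
  { destruct (Rtotal_order (f s) 0) as [h | [h | h]]; [|assumption|].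
    - exfalso; destruct (continuity_pt_locally_pos (fun u => - f u) s) as (d & hd & hd').
      + apply continuity_pt_opp, hc; lra.
      + lra.
      + assert (a < s) by (destruct has as [? | <-]; [assumption | lra]).
        set (u := Rmax a (s - d / 2)).
        assert (a <= u) by apply Rmax_l.
        assert (s - d / 2 <= u) by apply Rmax_r.
        assert (u < s) by (unfold u, Rmax; destruct Rle_dec; lra).
        assert (0 < f u) by (apply hlt; lra).
        assert (0 < - f u) by (apply hd', Rabs_def1; lra).
        lra.
    - exfalso; destruct (continuity_pt_locally_pos f s) as (d & hd & hd'); auto.
      assert (hsb' : s < b) by (destruct hsb as [? | ->]; [assumption | lra]).
      set (u := Rmin b (s + d / 2)).
      assert (u <= b) by apply Rmin_l.
      assert (u <= s + d / 2) by apply Rmin_r.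
      assert (s < u) by (unfold u, Rmin; destruct Rle_dec; lra).
      enough (u <= s) by lra.
      apply s1; split; [lra|]; intros v hv.
      destruct (Rlt_dec v s); [apply hlt; lra | apply hd', Rabs_def1; lra]. }
  exists s; split; [split; [|assumption]|split; assumption].
  destruct has as [? | <-]; [assumption | lra].
Qed.

Lemma is_derive_pos_locally (f : R -> R) (x l : R) :
  is_derive f x l -> 0 < l ->
  exists d, 0 < d /\ forall h, 0 < h < d -> f (x - h) < f x < f (x + h).
Proof.
intros hf hl; apply is_derive_Reals in hf; destruct (hf l hl) as [d hd].
exists d; split; [apply cond_pos|]; intros h hh; split.
- assert (A := hd (- h) ltac:(lra) ltac:(rewrite Rabs_Ropp, Rabs_pos_eq; lra)).
  apply Rabs_def2 in A; destruct A as [_ A].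
  assert (0 < (f (x + - h) - f x) / - h) by lra.
  unfold Rminus at 1.
  replace (f (x + - h)) with (f x - h * ((f (x + - h) - f x) / - h)) by (field; lra).
  nra.
- assert (A := hd h ltac:(lra) ltac:(rewrite Rabs_pos_eq; lra)).
  apply Rabs_def2 in A; destruct A as [_ A].
  assert (0 < (f (x + h) - f x) / h) by lra.
  replace (f (x + h)) with (f x + h * ((f (x + h) - f x) / h)) by (field; lra).
  nra.
Qed.

Lemma is_derive_zero_little (f : R -> R) (x eps : R) :
  is_derive f x 0 -> 0 < eps ->
  exists d, 0 < d /\ forall y, Rabs (y - x) < d -> Rabs (f y - f x) <= eps * Rabs (y - x).
Proof.
intros hf he; apply is_derive_Reals in hf; destruct (hf eps he) as [d hd].
exists d; split; [apply cond_pos|]; intros y hy.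
destruct (Req_dec y x) as [-> | hne].
- rewrite !Rminus_eq_0, Rabs_R0; lra.
- specialize (hd (y - x) ltac:(lra) hy).
  replace (x + (y - x)) with y in hd by ring; rewrite Rminus_0_r in hd.
  replace (f y - f x) with ((f y - f x) / (y - x) * (y - x)) by (field; lra).
  rewrite Rabs_mult; apply Rmult_le_compat_r; [apply Rabs_pos | lra].
Qed.

(** [auto_derive] leaves the derivatives of the coordinates in its result; the flow equations turn
    them into components of the field. *)
Ltac derive_along_flow z s hf :=
  let h1 := fresh in let h2 := fresh in let h3 := fresh in let h4 := fresh in
  assert (h1 := hf cq1); assert (h2 := hf cq2); assert (h3 := hf cp1); assert (h4 := hf cp2);
  cbv [coordinate gamma_field field_expr dist1 dist2] in h1, h2, h3, h4;
  auto_derive;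
  [ repeat split; try (eexists; eassumption)
  | try rewrite (is_derive_unique (fun x : R => Q1 z x) s _ h1);
    try rewrite (is_derive_unique (fun x : R => Q2 z x) s _ h2);
    try rewrite (is_derive_unique (fun x : R => P1 z x) s _ h3);
    try rewrite (is_derive_unique (fun x : R => P2 z x) s _ h4);
    clear h1 h2 h3 h4 ].

(** * Conservation of energy and the level [Gamma = 0] *)

Definition energy (m : R) (z : orbit) (s : R) : R := Gamma m (Q1 z s) (Q2 z s) (P1 z s) (P2 z s).

Lemma is_derive_energy (m : R) (z : orbit) (s : R) :
  m <> 0 -> 0 < dist1 (Q1 z s) (Q2 z s) -> flow (gamma_field m) (coordinate z) s ->
  is_derive (energy m z) s 0.
Proof.
intros hm hq hf.
assert (hq2 : 0 < dist2 (Q1 z s) (Q2 z s)) by (unfold dist1, dist2 in *; nra).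
unfold dist1, dist2 in *.
unfold energy, Gamma.
derive_along_flow z s hf.
- lra.
- lra.
- clear hf; generalize dependent (Q1 z s); intros q1; generalize (Q2 z s) (P1 z s) (P2 z s).
  intros; unfold E; field; repeat split; lra.
Qed.

Lemma energy_zero (m r a b : R) (z : orbit) (s : R) :
  0 < m -> solution m r a b z -> a < s < b -> energy m z s = 0.
Proof.
intros hm hz; apply (solution_iff_flow m r a b z) in hz; [|lra].
destruct hz as (hab & h0 & hf); intros hs.
assert (e0 : energy m z 0 = 0).
{ destruct (hf 0 ltac:(lra)) as [hq _]; unfold dist1 in hq.
  assert (i1 := h0 cq1); assert (i2 := h0 cq2); assert (i3 := h0 cp1); assert (i4 := h0 cp2).
  simpl in i1, i2, i3, i4; rewrite i1, i2 in hq.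
  unfold energy, Gamma; rewrite i1, i2, i3, i4.
  (* This makes [4 * q1 ^ 2 * p2 ^ 2 / (16 * m)] equal to [m ^ 2 * q1 ^ 2] initially, and all other
     terms contain [q2]. *)
  assert (hp : Rpower m (3 / 2) ^ 2 = m ^ 3).
  { rewrite <- !Rpower_pow, Rpower_mult by (auto using exp_pos || apply exp_pos).
    f_equal; simpl; lra. }
  rewrite Rpow_mult_distr, hp; field; repeat split; nra. }
rewrite <- e0.
assert (hd : forall u, Rmin 0 s <= u <= Rmax 0 s -> is_derive (energy m z) u 0).
{ intros u hu; destruct (hf u) as [hq hu'].
  - destruct (Rmin_Rmax_cases s) as [(? & ? & ?) | (? & ? & ?)]; lra.
  - apply is_derive_energy; auto; lra. }
(* With [c = K = 0] the growth estimate says that a function with zero derivative is constant. *)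
assert (A := exp_growth (energy m z) (fun _ => 0) 0 0 s hd).
assert (A' : Rabs (energy m z s - energy m z 0) <= 0 * (exp (0 * Rabs s) - 1)).
{ apply A; intros; rewrite Rabs_R0; lra. }
rewrite Rmult_0_l in A'; apply Rabs_le_between in A'; lra.
Qed.

(** With [p1 = 0] only [- 2 * m * q2 ^ 2] would survive. The point is that [Q1] then has nonzero
    speed at the SBC. *)
Lemma Gamma_zero_at_SBC (m q2 p1 p2 : R) :
  0 < m -> q2 <> 0 -> Gamma m 0 q2 p1 p2 = 0 -> p1 <> 0.
Proof.
intros hm hq hg ->; unfold Gamma in hg.
replace (_ - _) with (- 2 * m * q2 ^ 2) in hg by (field; split; nra).
assert (0 < q2 ^ 2) by (apply pow2_gt_0; assumption); nra.
Qed.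

(** With [p2 = 0] only [- m ^ 2 * q1 ^ 2] would survive. Hence zeros of [P2] avoid the inner
    collisions. *)
Lemma Gamma_zero_at_inner_collision (m q1 p1 p2 : R) :
  0 < m -> q1 <> 0 -> Gamma m q1 0 p1 p2 = 0 -> p2 <> 0.
Proof.
intros hm hq hg ->; unfold Gamma in hg.
replace (_ - _) with (- m ^ 2 * q1 ^ 2) in hg by (field; split; nra).
assert (0 < q1 ^ 2) by (apply pow2_gt_0; assumption).
assert (0 < m ^ 2) by (apply pow2_gt_0; lra); nra.
Qed.

(* At [p2 = 0] the derivative of [p2] has the sign of [- q2]: the mirror pair
   pulls the centre of mass of bodies 1 and 2 back. *)
Lemma P2_not_stationary_at_zero (m q1 q2 p1 : R) :
  0 < m -> q1 <> 0 -> q2 <> 0 -> Gamma m q1 q2 p1 0 = 0 ->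
  field_expr m q1 q2 p1 0 (/ dist1 q1 q2) (/ dist2 q1 q2) cp2 <> 0.
Proof.
intros hm h1 h2 hg.
assert (p1' : 0 < q1 * q1) by nra.
assert (p2' : 0 < q2 * q2) by nra.
assert (hd1 : 0 < dist1 q1 q2) by (unfold dist1; lra).
assert (hd2 : 0 < dist2 q1 q2) by (unfold dist2; lra).
set (e1 := / dist1 q1 q2); set (e2 := / dist2 q1 q2).
(* Adding [2 * Gamma], which is zero, cancels [p1], the inner collision term and the energy term. *)
assert (key : field_expr m q1 q2 p1 0 e1 e2 cp2 * q2 + 2 * Gamma m q1 q2 p1 0
  = - 2 * (q1 * q1) * (m * m + 2 * m * (q2 * q2 * e1) ^ 2 + (q2 * q2 * e2) ^ 2)).
{ unfold field_expr, Gamma, e1, e2, dist1, dist2, E in *; field; repeat split; lra. }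
intros h; fold e1 e2 in h; rewrite h, hg in key.
assert (0 <= (q2 * q2 * e1) ^ 2) by apply pow2_ge_0.
assert (0 <= (q2 * q2 * e2) ^ 2) by apply pow2_ge_0.
assert (0 < m * m) by nra.
assert (0 <= m * (q2 * q2 * e1) ^ 2) by nra.
assert (0 < q1 * q1 * (m * m + 2 * m * (q2 * q2 * e1) ^ 2 + (q2 * q2 * e2) ^ 2)) by nra.
nra.
Qed.

(** * Signs along an orbit up to its first SBC *)

Section OrbitToSBC.
Variables (m r a b : R) (z : orbit) (s1 : R).
Hypothesis hm : 0 < m.
Hypothesis hr : 0 < r.
Hypothesis hz : solution_to_SBC m r a b z s1.

Let sol : solution m r a b z := proj1 hz.
Let a0 : a < 0 := proj1 (proj1 sol).
Let b0 : 0 < b := proj2 (proj1 sol).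
Let s1b : s1 < b := proj1 (proj2 hz).
Let s1_pos : 0 < s1 := proj1 (proj2 (proj2 hz)).

Lemma continuity_pt_to_SBC (i : coord) (s : R) : 0 <= s <= s1 -> continuity_pt (coordinate z i) s.
Proof. intros hs; apply (solution_continuity_pt m r a b); auto; lra. Qed.

Lemma dist1_to_SBC (s : R) : 0 <= s <= s1 -> 0 < dist1 (Q1 z s) (Q2 z s).
Proof. intros hs; apply dist1_pos; apply sol; lra. Qed.

Lemma flow_to_SBC (s : R) : 0 <= s <= s1 -> flow (gamma_field m) (coordinate z) s.
Proof. intros hs; apply (solution_flow m r a b); auto; lra. Qed.

Lemma energy_to_SBC (s : R) : 0 <= s <= s1 -> Gamma m (Q1 z s) (Q2 z s) (P1 z s) (P2 z s) = 0.
Proof. intros hs; apply (energy_zero m r a b z s); auto; lra. Qed.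

Lemma initial_to_SBC (i : coord) : coordinate z i 0 = initial m r i.
Proof. apply (solution_iff_flow m r a b z); [lra | exact sol]. Qed.

(** A zero of [Q1] is either an SBC, and [s1] is the first, or total collapse, which [solution]
    excludes. *)
Lemma Q1_pos_before_SBC (s : R) : 0 <= s < s1 -> 0 < Q1 z s.
Proof.
intros hs; destruct (Rlt_dec 0 (Q1 z s)) as [h | h]; [assumption | exfalso].
destruct (first_zero (Q1 z) 0 s) as (t & ht & e & _); [lra | | | lra |].
- intros u hu; apply (continuity_pt_to_SBC cq1); lra.
- change (0 < coordinate z cq1 0); now rewrite initial_to_SBC.
- apply (proj2 (proj2 (proj2 (proj2 hz))) t); [lra|]; split; [assumption|].
  intros e2; apply (proj1 (proj2 (proj2 (proj2 (proj2 (proj2 sol)))) t ltac:(lra))); auto.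
Qed.

Lemma Q1_SBC : Q1 z s1 = 0. Proof. apply hz. Qed.

Lemma Q2_SBC : Q2 z s1 <> 0. Proof. apply hz. Qed.

Lemma Q1_nonneg_to_SBC (s : R) : 0 <= s <= s1 -> 0 <= Q1 z s.
Proof.
intros [h0 [h | ->]]; [left; apply Q1_pos_before_SBC; lra | rewrite Q1_SBC; lra].
Qed.

Lemma P1_SBC : P1 z s1 <> 0.
Proof.
assert (e := energy_to_SBC s1 ltac:(lra)); rewrite Q1_SBC in e.
exact (Gamma_zero_at_SBC _ _ _ _ hm Q2_SBC e).
Qed.

(* The velocity of the outer body is [P1 / (4 Q1)], and all forces on it point
   inwards. *)
Lemma P1_nonpos_before_SBC (s : R) : 0 <= s < s1 -> P1 z s <= 0.
Proof.
intros hs.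
set (v' := fun u => ((gamma_field m cp1 (fun i => coordinate z i u)) * Q1 z u
  - P1 z u * (gamma_field m cq1 (fun i => coordinate z i u))) / (Q1 z u * Q1 z u)).
assert (hv : - (P1 z 0 / Q1 z 0) <= - (P1 z s / Q1 z s)).
{ apply (is_derive_nonneg_le (fun u => - (P1 z u / Q1 z u)) (fun u => - v' u)); [lra | |].
  - intros u hu; assert (hq := Q1_pos_before_SBC u ltac:(lra)).
    assert (hf := flow_to_SBC u ltac:(lra)); unfold v'.
    assert (h1 := hf cq1); assert (h3 := hf cp1).
    auto_derive.
    + repeat split; [now eexists; exact h3 | now eexists; exact h1 | lra].
    + rewrite (is_derive_unique (fun x : R => Q1 z x) u _ h1),
        (is_derive_unique (fun x : R => P1 z x) u _ h3).
      field; lra.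
  - intros u hu; assert (hq := Q1_pos_before_SBC u ltac:(lra)).
    assert (hg := energy_to_SBC u ltac:(lra)).
    assert (hd := dist1_to_SBC u ltac:(lra)).
    unfold v', gamma_field; simpl coordinate.
    generalize dependent (Q1 z u); intros q1 hq; generalize (Q2 z u) (P1 z u) (P2 z u).
    intros q2 p1 p2 hg hd.
    assert (hd2 : 0 < dist2 q1 q2) by (unfold dist1, dist2 in *; nra).
    set (e1 := / dist1 q1 q2); set (e2 := / dist2 q1 q2).
    (* All terms in the momenta combine into [- 2 * Gamma]. The three summands left are the
       attractions by the three other bodies, times [q1 ^ 4]. *)
    assert (key : field_expr m q1 q2 p1 p2 e1 e2 cp1 * q1 - p1 * field_expr m q1 q2 p1 p2 e1 e2 cq1
      = - 2 * Gamma m q1 q2 p1 p2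
        - 4 * (q2 * q2) * (m + m * (q1 * q1 * e1) ^ 2 + (q1 * q1 * e2) ^ 2)).
    { unfold field_expr, Gamma, e1, e2, dist1, dist2, E in *; field; repeat split; lra. }
    rewrite key, hg.
    assert (hi : 0 < / (q1 * q1)) by (apply Rinv_0_lt_compat; nra).
    assert (0 <= (q1 * q1 * e1) ^ 2) by apply pow2_ge_0.
    assert (0 <= (q1 * q1 * e2) ^ 2) by apply pow2_ge_0.
    assert (0 <= m * (q1 * q1 * e1) ^ 2) by nra.
    assert (0 <= q2 * q2 * (m + m * (q1 * q1 * e1) ^ 2 + (q1 * q1 * e2) ^ 2)).
    { apply Rmult_le_pos; nra. }
    unfold Rdiv; nra. }
assert (i1 := initial_to_SBC cp1); simpl in i1.
rewrite i1 in hv; unfold Rdiv in hv; rewrite Rmult_0_l, Ropp_0 in hv.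
assert (hq := Q1_pos_before_SBC s ltac:(lra)).
assert (e : P1 z s = (P1 z s * / Q1 z s) * Q1 z s) by (field; lra).
rewrite e; nra.
Qed.

(** The quotient [P1 / Q1] is of no use at [s1], where [Q1] vanishes; continuity of [P1] covers this
    point. *)
Lemma P1_nonpos_to_SBC (s : R) : 0 <= s <= s1 -> P1 z s <= 0.
Proof.
intros [h0 [h | ->]]; [apply P1_nonpos_before_SBC; lra|].
destruct (Rle_dec (P1 z s1) 0) as [|hn]; [assumption | exfalso].
destruct (continuity_pt_locally_pos (P1 z) s1) as (d & hd & hp).
- apply (continuity_pt_to_SBC cp1); lra.
- lra.
- set (u := Rmax 0 (s1 - d / 2)).
  assert (0 <= u) by apply Rmax_l.
  assert (s1 - d / 2 <= u) by apply Rmax_r.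
  assert (u < s1) by (unfold u, Rmax; destruct Rle_dec; lra).
  assert (P1 z u <= 0) by (apply P1_nonpos_before_SBC; lra).
  assert (0 < P1 z u) by (apply hp, Rabs_def1; lra).
  lra.
Qed.

Lemma P1_neg_SBC : P1 z s1 < 0.
Proof.
assert (h := P1_nonpos_to_SBC s1 ltac:(lra)); assert (h' := P1_SBC); lra.
Qed.

(** At the SBC the derivative of [Q1] is [(/ 8 + / (8 * m)) * Q2 ^ 2 * P1 < 0]. A sign change,
    unlike a mere zero, persists under perturbation. *)
Lemma Q1_crosses_at_SBC :
  exists d, 0 < d /\ forall h, 0 < h < d -> Q1 z (s1 + h) < 0.
Proof.
assert (hf := flow_to_SBC s1 ltac:(lra) cq1).
assert (hd : is_derive (fun u => - Q1 z u) s1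
  (- gamma_field m cq1 (fun i => coordinate z i s1))).
{ apply (is_derive_opp (Q1 z)); exact hf. }
destruct (is_derive_pos_locally _ _ _ hd) as (d & hd0 & hd').
- unfold gamma_field, field_expr; simpl coordinate; rewrite Q1_SBC.
  assert (hp := P1_neg_SBC); assert (hq := Q2_SBC).
  assert (0 < Q2 z s1 * Q2 z s1) by nra.
  assert (0 < / (8 * m)) by (apply Rinv_0_lt_compat; lra).
  assert (Q2 z s1 * Q2 z s1 * P1 z s1 < 0) by nra.
  rewrite !Rmult_0_l, Rmult_0_r, Rplus_0_r; nra.
- exists d; split; [assumption|]; intros h hh; specialize (hd' h hh).
  rewrite Q1_SBC in hd'; lra.
Qed.

(** A zero inside ]0, s1[ would be a minimum of [P2], but [P2] is not stationary at its zeros there.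
    So an orbit that is not good and has [P2 z s1 <> 0] satisfies a strict inequality [P2 < 0]
    somewhere. *)
Lemma P2_pos_of_nonneg :
  (forall s, 0 <= s <= s1 -> 0 <= P2 z s) -> 0 < P2 z s1 ->
  forall s, 0 <= s <= s1 -> 0 < P2 z s.
Proof.
intros hn hp s hs; destruct (hn s hs) as [h | h]; [assumption | exfalso].
assert (h0 : P2 z 0 <> 0).
{ change (coordinate z cp2 0 <> 0); rewrite initial_to_SBC; simpl.
  assert (A := exp_pos (3 / 2 * ln m)); unfold Rpower; lra. }
assert (s <> 0) by (intros ->; auto).
assert (s <> s1) by (intros ->; lra).
assert (hs' : 0 < s < s1) by lra.
assert (hq1 := Q1_pos_before_SBC s ltac:(lra)).
assert (he := energy_to_SBC s hs).
assert (hq2 : Q2 z s <> 0).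
{ intros e; rewrite e in he.
  apply (Gamma_zero_at_inner_collision m (Q1 z s) (P1 z s) (P2 z s)); auto; lra. }
assert (hf := flow_to_SBC s hs cp2).
assert (hne : gamma_field m cp2 (fun i => coordinate z i s) <> 0).
{ unfold gamma_field; simpl coordinate; rewrite <- h in *.
  apply P2_not_stationary_at_zero; auto; lra. }
destruct (Rtotal_order (gamma_field m cp2 (fun i => coordinate z i s)) 0) as [hl | [hl | hl]];
  [| contradiction |].
- assert (hd : is_derive (fun u => - P2 z u) s (- gamma_field m cp2 (fun i => coordinate z i s))).
  { apply (is_derive_opp (P2 z)); exact hf. }
  destruct (is_derive_pos_locally _ _ _ hd ltac:(lra)) as (d & hd0 & hd').
  set (k := Rmin (d / 2) (s1 - s)).
  assert (k <= d / 2) by apply Rmin_l.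
  assert (k <= s1 - s) by apply Rmin_r.
  assert (0 < k) by (unfold k, Rmin; destruct Rle_dec; lra).
  specialize (hd' k ltac:(lra)); specialize (hn (s + k) ltac:(lra)); lra.
- destruct (is_derive_pos_locally _ _ _ hf ltac:(lra)) as (d & hd0 & hd').
  set (k := Rmin (d / 2) s).
  assert (k <= d / 2) by apply Rmin_l.
  assert (k <= s) by apply Rmin_r.
  assert (0 < k) by (unfold k, Rmin; destruct Rle_dec; lra).
  specialize (hd' k ltac:(lra)); specialize (hn (s - k) ltac:(lra)).
  simpl coordinate in hd'; lra.
Qed.

(* [Q1 P1 + Q2 P2] is the time derivative of the moment of inertia. By the
   Lagrange-Jacobi identity it increases as long as the potential exceeds 2, hence
   as long as [x1 < 1 / 4]; and [x1] decreases from [r^2]. *)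
Lemma P2_pos_of_small : r < 1 / 2 -> forall s, 0 <= s <= s1 -> 0 < P2 z s.
Proof.
intros hr2.
(* [dist2] is [2 * x1], with initial value [2 * r ^ 2]. *)
assert (hx : forall s, 0 <= s <= s1 -> dist2 (Q1 z s) (Q2 z s) < 1 / 2).
{ intros s hs.
  assert (hx : - dist2 (Q1 z 0) (Q2 z 0) <= - dist2 (Q1 z s) (Q2 z s)).
  { unfold dist2.
    apply (is_derive_nonneg_le (fun u => - (2 * (Q1 z u * Q1 z u) + Q2 z u * Q2 z u))
      (fun u => - (Q1 z u * (Q2 z u * Q2 z u) * P1 z u / 2))); [lra | |].
    - intros u hu; assert (hf := flow_to_SBC u ltac:(lra)).
      derive_along_flow z u hf; field; lra.
    - intros u hu; assert (hq := Q1_nonneg_to_SBC u ltac:(lra)).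
      assert (hp := P1_nonpos_to_SBC u ltac:(lra)).
      assert (0 <= Q1 z u * (Q2 z u * Q2 z u)) by (apply Rmult_le_pos; nra).
      nra. }
  assert (i1 := initial_to_SBC cq1); assert (i2 := initial_to_SBC cq2); simpl in i1, i2.
  rewrite i1, i2 in hx; unfold dist2 in *; nra. }
set (J := fun s => Q1 z s * P1 z s + Q2 z s * P2 z s).
assert (J0 : J 0 = 0).
{ assert (i1 := initial_to_SBC cp1); assert (i2 := initial_to_SBC cq2); simpl in i1, i2.
  unfold J; rewrite i1, i2; ring. }
assert (hJ : forall s, 0 < s <= s1 -> 0 < J s).
{ intros s hs; rewrite <- J0.
  (* By Euler's identity: the kinetic part of [Gamma] has degree 2 both in the [Q] and in the [P],
     so it cancels. The potential terms have degree 2 in the [Q] and the energy term has degree 4,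
     whence the [- 2] beside [/ dist2]. *)
  apply (is_derive_pos_lt J (fun u => 2 * (m * m * (Q1 z u * Q1 z u) + 2 * m * (Q2 z u * Q2 z u)
      + 2 * m * (Q1 z u * Q1 z u * (Q2 z u * Q2 z u)) * / dist1 (Q1 z u) (Q2 z u)
      + Q1 z u * Q1 z u * (Q2 z u * Q2 z u) * (/ dist2 (Q1 z u) (Q2 z u) - 2)))); [lra | |].
  - intros u hu; assert (hf := flow_to_SBC u ltac:(lra)).
    assert (hd := dist1_to_SBC u ltac:(lra)).
    assert (hd2 : 0 < dist2 (Q1 z u) (Q2 z u)) by (unfold dist1, dist2 in *; nra).
    unfold J, dist1, dist2 in *.
    derive_along_flow z u hf.
    field; repeat split; lra.
  - intros u hu; assert (hq := Q1_pos_before_SBC u ltac:(lra)).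
    assert (hd := dist1_to_SBC u ltac:(lra)); assert (hxu := hx u ltac:(lra)).
    assert (hd2 : 0 < dist2 (Q1 z u) (Q2 z u)) by (unfold dist1, dist2 in *; nra).
    assert (hi1 := Rinv_0_lt_compat _ hd).
    assert (hi2 : 2 < / dist2 (Q1 z u) (Q2 z u)).
    { replace 2 with (/ (1 / 2)) by field; apply Rinv_lt_contravar; lra. }
    assert (0 < m * m * (Q1 z u * Q1 z u)) by (repeat apply Rmult_lt_0_compat; lra).
    assert (h2 : 0 <= Q2 z u * Q2 z u) by nra.
    assert (0 <= m * (Q2 z u * Q2 z u)) by nra.
    assert (h12 : 0 <= Q1 z u * Q1 z u * (Q2 z u * Q2 z u)) by (apply Rmult_le_pos; nra).
    assert (0 <= 2 * m * (Q1 z u * Q1 z u * (Q2 z u * Q2 z u)) * / dist1 (Q1 z u) (Q2 z u)).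
    { apply Rmult_le_pos; nra. }
    nra. }
(* Where [P2] vanishes, [J] reduces to [Q1 * P1 <= 0]. *)
assert (hQP : forall s, 0 < s <= s1 -> P2 z s <> 0).
{ intros s hs e; specialize (hJ s hs); unfold J in hJ; rewrite e in hJ.
  assert (hq := Q1_nonneg_to_SBC s ltac:(lra)); assert (hp := P1_nonpos_to_SBC s ltac:(lra)); nra. }
assert (h0 : 0 < P2 z 0).
{ change (0 < coordinate z cp2 0); rewrite initial_to_SBC; simpl.
  assert (A := exp_pos (3 / 2 * ln m)); unfold Rpower; lra. }
intros s hs; destruct (Rlt_dec 0 (P2 z s)) as [h | h]; [assumption | exfalso].
destruct (first_zero (P2 z) 0 s) as (t & ht & e & _); [lra | | assumption | lra |].
- intros u hu; apply (continuity_pt_to_SBC cp2); lra.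
- apply (hQP t); [lra | assumption].
Qed.

(** * The second body of a good orbit *)

Section PositiveP2.
Hypothesis hP2 : forall s, 0 <= s <= s1 -> 0 < P2 z s.

(** At a zero of [Q2] its derivative is [Q1 ^ 2 * P2 / (2 * m) > 0]. So [Q2] leaves 0 upwards and
    can never come back down to it. *)
Lemma Q2_pos_to_SBC (s : R) : 0 < s <= s1 -> 0 < Q2 z s.
Proof.
assert (up : forall s, 0 <= s <= s1 -> Q2 z s = 0 ->
  exists d, 0 < d /\ forall h, 0 < h < d -> Q2 z (s - h) < 0 < Q2 z (s + h)).
{ intros t ht e; assert (hf := flow_to_SBC t ltac:(lra) cq2).
  destruct (is_derive_pos_locally _ _ _ hf) as (d & hd & hd').
  - unfold gamma_field, field_expr; simpl coordinate; rewrite e.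
    assert (hq := Q1_nonneg_to_SBC t ltac:(lra)); assert (hp := hP2 t ltac:(lra)).
    assert (hd := dist1_to_SBC t ltac:(lra)); rewrite e in hd; unfold dist1 in hd.
    assert (0 < / (4 * m)) by (apply Rinv_0_lt_compat; lra).
    assert (0 < Q1 z t * Q1 z t * P2 z t) by (apply Rmult_lt_0_compat; lra).
    nra.
  - exists d; split; [assumption|]; intros h hh; specialize (hd' h hh).
    simpl coordinate in hd'; rewrite e in hd'; assumption. }
intros hs; destruct (Rlt_dec 0 (Q2 z s)) as [h | h]; [assumption | exfalso].
destruct (up 0 ltac:(lra) (initial_to_SBC cq2)) as (d & hd & hd').
set (k := Rmin (d / 2) s).
assert (k <= d / 2) by apply Rmin_l.
assert (k <= s) by apply Rmin_r.
assert (0 < k) by (unfold k, Rmin; destruct Rle_dec; lra).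
assert (hk := proj2 (hd' k ltac:(lra))); rewrite Rplus_0_l in hk.
destruct (first_zero (Q2 z) k s) as (t & ht & e & hpos); [lra | | assumption | lra |].
- intros u hu; apply (continuity_pt_to_SBC cq2); lra.
- destruct (up t ltac:(lra) e) as (d' & hd0 & hd1).
  set (k' := Rmin (d' / 2) (t - k)).
  assert (k' <= d' / 2) by apply Rmin_l.
  assert (k' <= t - k) by apply Rmin_r.
  assert (0 < k') by (unfold k', Rmin; destruct Rle_dec; lra).
  assert (A := proj1 (hd1 k' ltac:(lra))); assert (A' := hpos (t - k') ltac:(lra)); lra.
Qed.

Lemma is_derive_physical_time (s : R) :
  a < s < b -> is_derive (physical_time z) s (Q1 z s ^ 2 * Q2 z s ^ 2).
Proof.
intros hs.
assert (hc : forall u, a < u < b -> continuous (fun u => Q1 z u ^ 2 * Q2 z u ^ 2) u).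
{ intros u hu; apply continuity_pt_filterlim.
  assert (c1 := solution_continuity_pt m r a b z cq1 u hm sol hu).
  assert (c2 := solution_continuity_pt m r a b z cq2 u hm sol hu).
  apply (continuity_pt_ext (fun u => (Q1 z u * Q1 z u) * (Q2 z u * Q2 z u))).
  - intros t; ring.
  - apply (continuity_pt_mult (fun u => Q1 z u * Q1 z u) (fun u => Q2 z u * Q2 z u));
      now apply continuity_pt_mult. }
apply (is_derive_RInt (fun u => Q1 z u ^ 2 * Q2 z u ^ 2) (physical_time z) 0 s).
- assert (hd : 0 < Rmin (s - a) (b - s)) by (unfold Rmin; destruct Rle_dec; lra).
  assert (d1 := Rmin_l (s - a) (b - s)); assert (d2 := Rmin_r (s - a) (b - s)).
  exists (mkposreal _ hd); intros t ht; change (Rabs (t - s) < Rmin (s - a) (b - s)) in ht.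
  apply Rabs_def2 in ht.
  apply (RInt_correct (V := R_CompleteNormedModule)), (ex_RInt_continuous (V := R_CompleteNormedModule)).
  intros u hu; apply hc; destruct (Rmin_Rmax_cases t) as [(? & ? & ?) | (? & ? & ?)]; lra.
- now apply hc.
Qed.

Lemma physical_time_0 : physical_time z 0 = 0.
Proof. exact (RInt_point (V := R_CompleteNormedModule) 0 _). Qed.

(* If [x2] has derivative 0 at time [t = physical_time z s], then
   [x2 - eps * t] cannot be increasing on the left of [t]. But its derivative in
   [s] is [Q1 Q2 ((2 Q1 P2 - Q2 P1) / (4 m) - eps Q1 Q2)], where the bracket is
   positive for small [eps], even at the SBC, where [Q1] vanishes. *)
Lemma second_body_does_not_turn : ~ second_body_turns a b z s1.
Proof.
intros (x2 & hx2 & t & ht & v & ta & tb & htt & hv & vt & _).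
assert (hx : is_derive x2 t 0) by (rewrite <- vt; apply hv; lra).
assert (hpt : forall s, 0 <= s <= s1 -> is_derive (physical_time z) s (Q1 z s ^ 2 * Q2 z s ^ 2)).
{ intros s hs; apply is_derive_physical_time; lra. }
destruct (first_zero (fun s => t - physical_time z s) 0 s1) as (s & hs & e & _).
- lra.
- intros u hu; apply continuity_pt_minus; [apply continuity_pt_const; now intros x y|].
  exact (is_derive_continuity_pt _ _ _ (hpt u hu)).
- rewrite physical_time_0; lra.
- lra.
- assert (et : physical_time z s = t) by lra; clear e.
  (* [w] is the derivative of [Q2] divided by [Q1]; the velocity of the second body is
     [w / (Q1 * Q2)], but [w] stays finite at the SBC. *)
  set (w := fun u => (2 * (Q1 z u * P2 z u) - Q2 z u * P1 z u) / (4 * m)).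
  assert (hw : 0 < w s).
  { assert (q1 := Q1_nonneg_to_SBC s ltac:(lra)); assert (q2 := Q2_pos_to_SBC s ltac:(lra)).
    assert (p1 := P1_nonpos_to_SBC s ltac:(lra)); assert (p2 := hP2 s ltac:(lra)).
    apply Rdiv_lt_0_compat; [|lra].
    destruct (Rle_lt_or_eq_dec _ _ q1) as [hq | hq]; [nra|].
    assert (s = s1).
    { destruct (Req_dec s s1); [assumption|].
      assert (A := Q1_pos_before_SBC s ltac:(lra)); lra. }
    subst s; assert (A := P1_neg_SBC); nra. }
  (* Chosen so that [eps * Rabs (Q1 z s * Q2 z s) < w s / 2]; the [+ 1] covers the SBC, where the
     product is 0. *)
  set (eps := w s / (2 * (Rabs (Q1 z s * Q2 z s) + 1))).
  assert (hq := Rabs_pos (Q1 z s * Q2 z s)).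
  assert (heps : 0 < eps) by (apply Rdiv_lt_0_compat; lra).
  assert (hbr : 0 < w s - eps * (Q1 z s * Q2 z s)).
  { assert (A := Rle_abs (Q1 z s * Q2 z s)).
    replace (w s) with (eps * (2 * (Rabs (Q1 z s * Q2 z s) + 1))) by (unfold eps; field; lra).
    nra. }
  assert (hcont : forall i, continuity_pt (coordinate z i) s).
  { intros i; apply continuity_pt_to_SBC; lra. }
  destruct (continuity_pt_locally_pos (fun u => w u - eps * (Q1 z u * Q2 z u)) s) as (d & hd & hd').
  { assert (c1 := hcont cq1); assert (c2 := hcont cq2);
      assert (c3 := hcont cp1); assert (c4 := hcont cp2).
    apply continuity_pt_minus.
    - unfold w, Rdiv; apply (continuity_pt_mult (fun u => 2 * (Q1 z u * P2 z u) - Q2 z u * P1 z u)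
        (fun _ => / (4 * m))); [|apply continuity_pt_const; now intros x y].
      apply continuity_pt_minus; [apply continuity_pt_mult;
        [apply continuity_pt_const; now intros x y|]|]; now apply continuity_pt_mult.
    - apply continuity_pt_mult; [apply continuity_pt_const; now intros x y|].
      now apply continuity_pt_mult. }
  { exact hbr. }
  destruct (is_derive_zero_little x2 t eps hx heps) as (d1 & hd1 & hd1').
  assert (hpc : continuity_pt (physical_time z) s).
  { exact (is_derive_continuity_pt _ _ _ (hpt s ltac:(lra))). }
  destruct (continuity_pt_locally_pos (fun u => physical_time z u - (t - d1)) s)
    as (d2 & hd2 & hd2').
  { apply continuity_pt_minus; [assumption | apply continuity_pt_const; now intros x y]. }
  { lra. }
  set (k := Rmin (Rmin (d / 2) (d2 / 2)) (s / 2)).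
  assert (hk : 0 < k) by (unfold k, Rmin; repeat destruct Rle_dec; lra).
  assert (hk1 : k <= d / 2) by (eapply Rle_trans; [apply Rmin_l | apply Rmin_l]).
  assert (hk2 : k <= d2 / 2) by (eapply Rle_trans; [apply Rmin_l | apply Rmin_r]).
  assert (hk3 : k <= s / 2) by apply Rmin_r.
  set (u := s - k).
  assert (hu : 0 < u < s) by (unfold u; lra).
  assert (ptu : physical_time z u < physical_time z s).
  { apply (is_derive_pos_lt (physical_time z) (fun v => Q1 z v ^ 2 * Q2 z v ^ 2)); [lra | |].
    - intros x hx'; apply hpt; lra.
    - intros x hx'; assert (A := Q1_pos_before_SBC x ltac:(lra)).
      assert (A' := Q2_pos_to_SBC x ltac:(lra)).
      apply Rmult_lt_0_compat; apply pow_lt; assumption. }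
  assert (hG : Q2 z u ^ 2 / 2 - eps * physical_time z u < Q2 z s ^ 2 / 2 - eps * physical_time z s).
  { apply (is_derive_pos_lt (fun x => Q2 z x ^ 2 / 2 - eps * physical_time z x)
      (fun x => Q1 z x * Q2 z x * (w x - eps * (Q1 z x * Q2 z x)))); [lra | |].
    - intros x hx'; assert (h2 := flow_to_SBC x ltac:(lra) cq2).
      assert (hp := hpt x ltac:(lra)).
      auto_derive; [repeat split; eexists; eassumption|].
      rewrite (is_derive_unique (fun x : R => Q2 z x) x _ h2),
        (is_derive_unique (fun x : R => physical_time z x) x _ hp).
      unfold w, gamma_field; simpl; field; lra.
    - intros x hx'; assert (A := Q1_pos_before_SBC x ltac:(lra)).
      assert (A' := Q2_pos_to_SBC x ltac:(lra)).
      apply Rmult_lt_0_compat; [now apply Rmult_lt_0_compat|].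
      apply hd', Rabs_def1; unfold u in hx'; lra. }
  assert (B2 : 0 < physical_time z u - (t - d1)).
  { apply hd2', Rabs_def1; unfold u; lra. }
  assert (hl := hd1' (physical_time z u) ltac:(apply Rabs_def1; lra)).
  rewrite (Rabs_left (physical_time z u - t)) in hl by lra.
  rewrite (hx2 u ltac:(lra)), <- et, (hx2 s ltac:(lra)) in hl.
  apply Rabs_le_between in hl; lra.
Qed.
End PositiveP2.

(** On [0, s1 - k] [Q1] has a positive minimum, and at [s1 + k] it is negative. An orbit closer than
    both margins has its first zero of [Q1] in between, and this zero is an SBC because total
    collapse is excluded. *)
Lemma SBC_perturb (eps : R) :
  0 < eps ->
  exists delta, 0 < delta /\ forall r', Rabs (r' - r) < delta ->
    exists a' b' y s1', solution_to_SBC m r' a' b' y s1' /\ Rabs (s1' - s1) < eps /\ s1' < b /\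
      forall s, 0 <= s <= s1' -> Rabs (P2 y s - P2 z s) < eps.
Proof.
intros heps.
destruct Q1_crosses_at_SBC as (d & hd & hcross).
(* The new solution will run up to [s1 + 2 * k < b], so that [s1 + k] lies inside its open
   interval. *)
set (k := Rmin (Rmin (d / 2) (eps / 2)) (Rmin (s1 / 2) ((b - s1) / 3))).
assert (hk : 0 < k) by (unfold k, Rmin; repeat destruct Rle_dec; lra).
assert (hk1 : k <= d / 2) by (eapply Rle_trans; [apply Rmin_l | apply Rmin_l]).
assert (hk2 : k <= eps / 2) by (eapply Rle_trans; [apply Rmin_l | apply Rmin_r]).
assert (hk3 : k <= s1 / 2) by (eapply Rle_trans; [apply Rmin_r | apply Rmin_l]).
assert (hk4 : k <= (b - s1) / 3) by (eapply Rle_trans; [apply Rmin_r | apply Rmin_r]).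
assert (hneg := hcross k ltac:(lra)).
destruct (continuity_pos_lower_bound (Q1 z) 0 (s1 - k)) as (c & hc & hlow).
{ intros s hs; split; [apply (continuity_pt_to_SBC cq1); lra | apply Q1_pos_before_SBC; lra]. }
set (e := Rmin eps (Rmin c (- Q1 z (s1 + k)))).
assert (he : 0 < e) by (unfold e, Rmin; repeat destruct Rle_dec; lra).
assert (he1 : e <= eps) by apply Rmin_l.
assert (he2 : e <= c) by (eapply Rle_trans; [apply Rmin_r | apply Rmin_l]).
assert (he3 : e <= - Q1 z (s1 + k)) by (eapply Rle_trans; [apply Rmin_r | apply Rmin_r]).
destruct (solution_perturb m r a b z (a / 2) (s1 + 2 * k) e) as (delta & hdelta & hpert);
  auto; try lra.
exists delta; split; [assumption|]; intros r' hr'.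
destruct (hpert r' hr') as (y & hy & near).
assert (hQ : forall s, 0 <= s <= s1 - k -> 0 < Q1 y s).
{ intros s hs; assert (A := hlow s hs); assert (A' := near s cq1 ltac:(lra)).
  simpl coordinate in A'; apply Rabs_def2 in A'; lra. }
destruct (first_zero (Q1 y) 0 (s1 + k)) as (s1' & hs1' & e1' & hpos).
- lra.
- intros s hs; apply (solution_continuity_pt m r' (a / 2) (s1 + 2 * k) y cq1); auto; lra.
- apply hQ; lra.
- assert (A' := near (s1 + k) cq1 ltac:(lra)); simpl coordinate in A'; apply Rabs_def2 in A'; lra.
- assert (hlo : s1 - k < s1').
  { destruct (Rlt_dec (s1 - k) s1') as [|hn]; [assumption|].
    assert (A := hQ s1' ltac:(lra)); lra. }
  exists (a / 2), (s1 + 2 * k), y, s1'; split; [|split; [|split]].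
  + split; [assumption | split; [lra|]]; split; [lra | split].
    * split; [assumption|]; intros e2.
      apply (proj1 (proj2 (proj2 (proj2 (proj2 (proj2 hy)))) s1' ltac:(lra))); auto.
    * intros s hs [e0 _]; assert (A := hpos s ltac:(lra)); lra.
  + apply Rabs_def1; lra.
  + lra.
  + intros s hs; assert (A := near s cp2 ltac:(lra)); simpl coordinate in A; lra.
Qed.

End OrbitToSBC.

(** * Good initial values and their supremum *)

Lemma SBC_unique (m r a b a' b' : R) (z w : orbit) (s1 s1' : R) :
  0 < m -> solution_to_SBC m r a b z s1 -> solution_to_SBC m r a' b' w s1' -> s1 = s1'.
Proof.
intros hm.
assert (key : forall a b a' b' z w s1 s1', solution_to_SBC m r a b z s1 ->
  solution_to_SBC m r a' b' w s1' -> ~ s1 < s1').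
{ clear - hm; intros a b a' b' z w s1 s1' (hz & hb & h0 & [e1 e2] & _) (hw & hb' & h0' & _ & hfirst) hlt.
  assert (U := solution_unique m r a b a' b' z w s1 hm hz hw ltac:(lra) ltac:(lra) ltac:(lra)).
  assert (U1 := U cq1); assert (U2 := U cq2); simpl in U1, U2.
  apply (hfirst s1); [lra|]; split; congruence. }
intros hz hw.
assert (A1 := key a b a' b' z w s1 s1' hz hw).
assert (A2 := key a' b' a b w z s1' s1 hw hz); lra.
Qed.

(** Existence of the SBC is part of the condition, so its openness also yields collisions beyond
    [sqrt A0]. *)
Definition reaches_SBC_with_P2_pos (m r : R) : Prop :=
  exists a b z s1, solution_to_SBC m r a b z s1 /\ forall s, 0 <= s <= s1 -> 0 < P2 z s.

Lemma P2_pos_open (m r : R) :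
  0 < m -> 0 < r -> reaches_SBC_with_P2_pos m r ->
  exists delta, 0 < delta /\
    forall r', Rabs (r' - r) < delta -> reaches_SBC_with_P2_pos m r'.
Proof.
intros hm hr (a & b & z & s1 & hz & hp).
assert (hcont : forall s, 0 <= s <= s1 -> continuity_pt (P2 z) s).
{ intros s hs; apply (continuity_pt_to_SBC m r a b z s1 hm hz cp2 s hs). }
destruct (continuity_pos_lower_bound (P2 z) 0 s1) as (c & hc & hlow); [now split; auto|].
assert (hs1 : 0 < s1) by apply hz.
(* A nearby orbit may collide later than [s1], so [P2 z] needs a lower bound slightly past [s1]. *)
destruct (continuity_pt_locally_pos (fun s => P2 z s - c / 2) s1) as (d & hd & hd').
{ apply continuity_pt_minus; [apply hcont; lra | apply continuity_pt_const; now intros x y]. }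
{ assert (A := hlow s1 ltac:(lra)); lra. }
set (eps := Rmin d (c / 2)).
assert (he1 : eps <= d) by apply Rmin_l.
assert (he2 : eps <= c / 2) by apply Rmin_r.
assert (he : 0 < eps) by (unfold eps, Rmin; destruct Rle_dec; lra).
destruct (SBC_perturb m r a b z s1 hm hr hz eps he) as (delta & hdelta & hpert).
exists delta; split; [assumption|]; intros r' hr'.
destruct (hpert r' hr') as (a' & b' & y & s1' & hy & hs & hb & near).
exists a', b', y, s1'; split; [assumption|]; intros s hs'.
assert (A := near s hs'); apply Rabs_def2 in A; apply Rabs_def2 in hs.
destruct (Rle_dec s s1).
- assert (A' := hlow s ltac:(lra)); lra.
- assert (A' : 0 < P2 z s - c / 2) by (apply hd', Rabs_def1; lra); lra.
Qed.

(** Here [P2] is negative at some time strictly before [s1]. Nearby orbits collide only after that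
    time and have [P2 < 0] at it. *)
Lemma P2_not_pos_open (m r a b : R) (z : orbit) (s1 : R) :
  0 < m -> 0 < r -> solution_to_SBC m r a b z s1 -> P2 z s1 <> 0 ->
  ~ reaches_SBC_with_P2_pos m r ->
  exists delta, 0 < delta /\
    forall r', Rabs (r' - r) < delta -> ~ reaches_SBC_with_P2_pos m r'.
Proof.
intros hm hr hz hne hnot.
assert (hs1 : 0 < s1) by apply hz.
assert (hcont : forall s, 0 <= s <= s1 -> continuity_pt (P2 z) s).
{ intros s hs; apply (continuity_pt_to_SBC m r a b z s1 hm hz cp2 s hs). }
assert (hneg : exists s, 0 <= s < s1 /\ P2 z s < 0).
{ apply NNPP; intros hn.
  assert (h1 : forall s, 0 <= s < s1 -> 0 <= P2 z s).
  { intros s hs; destruct (Rlt_dec (P2 z s) 0); [exfalso; apply hn; exists s; auto | lra]. }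
  assert (h2 : 0 <= P2 z s1).
  { destruct (Rlt_dec (P2 z s1) 0) as [hlt|]; [exfalso | lra].
    destruct (continuity_pt_locally_pos (fun s => - P2 z s) s1) as (d & hd & hd').
    - apply continuity_pt_opp, hcont; lra.
    - lra.
    - set (u := Rmax 0 (s1 - d / 2)).
      assert (0 <= u) by apply Rmax_l.
      assert (s1 - d / 2 <= u) by apply Rmax_r.
      assert (u < s1) by (unfold u, Rmax; destruct Rle_dec; lra).
      assert (0 < - P2 z u) by (apply hd', Rabs_def1; lra).
      assert (A := h1 u ltac:(lra)); lra. }
  apply hnot; exists a, b, z, s1; split; [assumption|].
  apply (P2_pos_of_nonneg m r a b z s1 hm hr hz); [|lra].
  intros s [hs [h | ->]]; [apply h1; lra | assumption]. }
destruct hneg as (s & hs & hneg).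
set (eps := Rmin (s1 - s) (- P2 z s)).
assert (he1 : eps <= s1 - s) by apply Rmin_l.
assert (he2 : eps <= - P2 z s) by apply Rmin_r.
assert (he : 0 < eps) by (unfold eps, Rmin; destruct Rle_dec; lra).
destruct (SBC_perturb m r a b z s1 hm hr hz eps he) as (delta & hdelta & hpert).
exists delta; split; [assumption|]; intros r' hr' (a'' & b'' & w & s1'' & hw & hp).
destruct (hpert r' hr') as (a' & b' & y & s1' & hy & hs' & hb & near).
assert (e := SBC_unique m r' a' b' a'' b'' y w s1' s1'' hm hy hw); subst s1''.
apply Rabs_def2 in hs'.
assert (A := near s ltac:(lra)); apply Rabs_def2 in A.
(* The orbit [w] that witnesses goodness need not be the perturbed orbit [y]; uniqueness identifies
   them at [s]. *)
assert (U : P2 y s = P2 w s).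
{ apply (solution_unique m r' a' b' a'' b'' y w s hm (proj1 hy) (proj1 hw)) with (i := cp2);
    [lra | |].
  - assert (s1' < b') by apply hy; lra.
  - assert (s1' < b'') by apply hw; lra. }
assert (A' := hp s ltac:(lra)); lra.
Qed.

Theorem corollary3 :
  forall (m : R) (hm : 0 < m) (A0 : R) (hA0 : is_A0 m A0),
  exists r : R, 0 < r <= sqrt A0 /\
    exists (a b : R) (z : orbit) (s1 : R),
      solution_to_SBC m r a b z s1 /\ P2 z s1 = 0.
Proof.
intros m hm A0 (hA & hle & hgt).
apply NNPP; intros hno.
set (rho := sqrt A0).
assert (hrho : 0 < rho) by (apply sqrt_lt_R0; assumption).
assert (erho : rho * rho = A0) by (apply sqrt_sqrt; lra).
(* Up to [rho] the existence of an SBC is part of [is_A0]; beyond [rho] it will come from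
   stability. *)
assert (hex : forall r, 0 < r <= rho -> exists a b z s1, solution_to_SBC m r a b z s1).
{ intros r hr; destruct (hle (r * r)) as [h _]; [nra|].
  rewrite sqrt_square in h by lra; exact h. }
set (good := reaches_SBC_with_P2_pos m).
assert (hsmall : good (Rmin rho (1 / 4))).
{ set (r := Rmin rho (1 / 4)).
  assert (r <= rho) by apply Rmin_l; assert (r <= 1 / 4) by apply Rmin_r.
  assert (0 < r) by (unfold r, Rmin; destruct Rle_dec; lra).
  destruct (hex r ltac:(lra)) as (a & b & z & s1 & hz).
  exists a, b, z, s1; split; [assumption|].
  apply (P2_pos_of_small m r a b z s1); auto; lra. }
destruct (completeness (fun r => 0 < r <= rho /\ good r)) as [R1 [h1 h2]].
{ exists rho; intros r hr; apply hr. }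
{ exists (Rmin rho (1 / 4)); split; [split; [|apply Rmin_l] | exact hsmall].
  unfold Rmin; destruct Rle_dec; lra. }
assert (hR1 : 0 < R1 <= rho).
{ split; [|apply h2; intros r hr; apply hr].
  apply Rlt_le_trans with (Rmin rho (1 / 4)); [unfold Rmin; destruct Rle_dec; lra|].
  apply h1; split; [split; [|apply Rmin_l] | exact hsmall].
  unfold Rmin; destruct Rle_dec; lra. }
assert (hgood : good R1).
{ apply NNPP; intros hbad.
  destruct (hex R1 hR1) as (a & b & z & s1 & hz).
  assert (hne : P2 z s1 <> 0).
  { intros e; apply hno; exists R1; split; [exact hR1|]; now exists a, b, z, s1. }
  destruct (P2_not_pos_open m R1 a b z s1 hm (proj1 hR1) hz hne hbad) as (d & hd & hd').
  (* If no [r] in ]R1 - d, R1] is good, then [R1 - d] is already an upper bound. *)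
  enough (R1 <= R1 - d) by lra.
  apply h2; intros r [hr hg]; destruct (Rle_dec r (R1 - d)) as [|hn]; [assumption | exfalso].
  assert (r <= R1) by (apply h1; auto).
  apply (hd' r); [apply Rabs_def1; lra | exact hg]. }
destruct (P2_pos_open m R1 hm (proj1 hR1) hgood) as (d & hd & hd').
assert (eR1 : R1 = rho).
{ apply NNPP; intros hne.
  set (r := Rmin rho (R1 + d / 2)).
  assert (r <= rho) by apply Rmin_l; assert (r <= R1 + d / 2) by apply Rmin_r.
  assert (R1 < r) by (unfold r, Rmin; destruct Rle_dec; lra).
  enough (r <= R1) by lra.
  apply h1; split; [lra|]; apply hd', Rabs_def1; lra. }
set (r := rho + d / 2).
assert (hr : good r) by (apply hd', Rabs_def1; unfold r; lra).
destruct hr as (a & b & z & s1 & hz & hp).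
assert (hr0 : 0 < r) by (unfold r; lra).
apply (second_body_does_not_turn m r a b z s1 hm hr0 hz hp).
apply (hgt (r * r)).
- rewrite <- erho; unfold r; nra.
- rewrite sqrt_square by lra; exact hz.
Qed.
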